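(* Let $d\ge 2$ be an integer, let $\lambda_n>0$ and $\beta_n\in\mathbb{R}$ ($n\ge 0$). The Jacobi operator $J$ on $\ell^2(\Lambda_d)$ has a pure point spectrum $\sigma(J)$, i.e. there is an orthonormal basis of $\ell^2(\Lambda_d)$ consisting of eigenvectors for $J$. Moreover, $\sigma(J)$ coincides with the closure of the set of all roots of the polynomials $p_n$, $n\ge 1$, determined by $$t\,p_n(t)=\sqrt d\,\lambda_{n-1}p_{n-1}(t)+\beta_np_n(t)+\sqrt d\,\lambda_np_{n+1}(t),\quad n\ge 0,\qquad p_{-1}=0,\ p_0=1.$$
   Context: $\Lambda_d$ is the vertex set of the infinite tree with one end and infinitely many origins: there is a length function $|\cdot|:\Lambda_d\to\mathbb{N}_0$ such that every vertex $x$ has exactly one successor $x_0$, with $|x_0|=|x|+1$; every vertex $x$ with $|x|\ge 1$ has exactly $d$ predecessors $x_1,\dots,x_d$ (the vertices whose successor is $x$, all of length $|x|-1$); vertices of length $0$ have no predecessor; the edges join each vertex to its successor and the resulting graph is connected (equivalently, any two vertices have a common iterated successor). $\ell^2(\Lambda_d)$ is the complex Hilbert space of square-summable functions on $\Lambda_d$, and $\delta_x$ is the characteristic function of $\{x\}$. The operator $J$ has domain $D(J)=\operatorname{lin}\{\delta_x: x\in\Lambda_d\}$ and acts by $$J\delta_x=\lambda_{n-1}(\delta_{x_1}+\dots+\delta_{x_d})+\beta_n\delta_x+\lambda_n\delta_{x_0},\qquad n=|x|,$$ where for $|x|=0$ the first term is absent (convention $\lambda_{-1}=0$). The operator $J$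 is essentially selfadjoint for all such coefficients, and $\sigma(J)$ denotes the spectrum of its closure. *)

(* Defs.v *)
From HB Require Import structures.
From Stdlib Require Import Relation_Operators.
From mathcomp Require Import all_boot all_order all_algebra.
From mathcomp Require Import complex ring.
From mathcomp Require Import mathcomp_extra boolp classical_sets functions.
From mathcomp Require Import cardinality fsbigop reals ereal topology normedtype.
From mathcomp Require Import numfun esum.

Set Implicit Arguments.
Unset Strict Implicit.
Unset Printing Implicit Defensive.

Import Order.TTheory GRing.Theory Num.Theory.
Import numFieldNormedType.Exports.
Import ComplexField.Normc.

Local Open Scope classical_set_scope.
Local Open Scope ring_scope.
Local Open Scope complex_scope.

(* These axioms determine the tree up to isomorphism.  Nonemptiness, implicit
   in the usual description, excludes the empty type. *)
Record tree (d : nat) := Tree {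
  vertex :> choiceType;
  len : vertex -> nat;
  succ : vertex -> vertex;
  len_succ : forall x, len (succ x) = (len x).+1;
  card_preds : forall x, (1 <= len x)%N ->
    (succ @^-1` [set x] #= `I_d)%card;
  preds_origin : forall x, len x = 0%N -> succ @^-1` [set x] = set0;
  tree_connected :
    forall x y, clos_refl_sym_trans vertex (fun u v => succ u = v) x y;
  tree_nonempty : inhabited vertex }.

Arguments len {d t} x : rename.
Arguments succ {d t} x : rename.

Section square_summable.
Context {R : realType} {V : choiceType}.
Implicit Types f g : V -> R[i].

Definition sqnorm f : \bar R := (\esum_(x in [set: V]) (normc (f x) ^+ 2)%:E)%E.

Definition square_summable : {pred V -> R[i]} :=
  [pred f | `[< (sqnorm f < +oo)%E >]].

Lemma sqnorm_ge0 f : (0 <= sqnorm f)%E.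
Proof. by apply: esum_ge0 => x _; rewrite lee_fin sqr_ge0. Qed.

Lemma normc_ge0 (z : R[i]) : 0 <= normc z.
Proof. by case: z => a b; rewrite sqrtr_ge0. Qed.

Lemma ge0_esumZl (r : R) (a : V -> \bar R) : 0 <= r -> (forall x, 0 <= a x)%E ->
  (\esum_(x in [set: V]) (r%:E * a x) = r%:E * \esum_(x in [set: V]) a x)%E.
Proof.
move=> r0 a0; rewrite /esum -ereal_supZl //; last first.
  apply/set0P; exists 0%E; exists set0; last by rewrite fsbig_set0.
  exact: fsets_set0.
congr ereal_sup; rewrite image_comp; apply/eq_imagel => A _ /=.
by rewrite ge0_mule_fsumr.
Qed.

Lemma sqnormZ (a : R[i]) f : sqnorm (a *: f) = ((normc a ^+ 2)%:E * sqnorm f)%E.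
Proof.
rewrite /sqnorm -ge0_esumZl ?sqr_ge0 //; last by move=> x; rewrite lee_fin sqr_ge0.
by apply: eq_esum => x _; rewrite -EFinM -exprMn -normcM.
Qed.

Lemma sqnormD f g (s t : R) : 0 < s -> 0 < t ->
  (sqnorm (f + g)%R
   <= ((s + t) / s)%R%:E * sqnorm f + ((s + t) / t)%R%:E * sqnorm g)%E.
Proof.
move=> s0 t0.
have st_ge0 u : 0 < u -> 0 <= (s + t) / u.
  by move=> u0; rewrite divr_ge0 ?addr_ge0 // ltW.
have sq0 (h : V -> R[i]) x : (0 <= (normc (h x) ^+ 2)%:E)%E.
  by rewrite lee_fin sqr_ge0.
rewrite /sqnorm -!ge0_esumZl ?st_ge0 // -esumD; last 2 first.
- by move=> x _; rewrite mule_ge0 // lee_fin st_ge0.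
- by move=> x _; rewrite mule_ge0 // lee_fin st_ge0.
apply: le_esum => x _; rewrite -!EFinM -EFinD lee_fin.
set a := normc (f x); set b := normc (g x).
have ab : normc ((f + g) x) <= a + b by exact: le_normcD.
apply: (@le_trans _ _ ((a + b) ^+ 2)).
  by rewrite lerXn2r // nnegrE ?addr_ge0 ?normc_ge0.
rewrite -subr_ge0; have -> : (s + t) / s * a ^+ 2 + (s + t) / t * b ^+ 2
    - (a + b) ^+ 2 = (t * a - s * b) ^+ 2 / (s * t).
  by field; rewrite !lt0r_neq0.
by rewrite divr_ge0 ?sqr_ge0 // mulr_ge0 // ltW.
Qed.

Lemma sqnorm_eq0 f : sqnorm f = 0%E -> f = 0.
Proof.
move=> f0; apply/funext => x; apply: eq0_normc; apply/eqP.
rewrite -(sqrf_eq0 (normc (f x))) eq_le sqr_ge0 andbT -lee_fin.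
apply: (@le_trans _ _ (sqnorm f)); last by rewrite f0.
apply: esum_ge; exists [set x]; first by split.
by rewrite fsbig_set1.
Qed.

Lemma sqnorm0 : sqnorm 0 = 0%E.
Proof. by apply: esum1 => x _; rewrite normc0 expr0n. Qed.

Fact square_summable_submod : submod_closed square_summable.
Proof.
split; first by apply/asboolP; rewrite sqnorm0.
move=> a f g /asboolP foo /asboolP goo; apply/asboolP.
apply: le_lt_trans (sqnormD _ _ ltr01 ltr01) _; rewrite sqnormZ.
by rewrite lte_add_pinfty // !lte_mul_pinfty ?lee_fin ?sqr_ge0 //= ?mule_ge0
  ?sqnorm_ge0 ?lee_fin ?sqr_ge0 // ?lte_mul_pinfty ?lee_fin ?sqr_ge0.
Qed.

HB.instance Definition _ :=
  GRing.isSubmodClosed.Build R[i] (V -> R[i]) square_summable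
    square_summable_submod.

End square_summable.

Definition l2 (R : realType) (V : choiceType) : Type :=
  {f : V -> R[i] | f \in square_summable}.

Section l2_module.
Context {R : realType} {V : choiceType}.

HB.instance Definition _ := [isSub of l2 R V for @sval _ _].
HB.instance Definition _ := [Choice of l2 R V by <:].
HB.instance Definition _ := [SubChoice_isSubLmodule of l2 R V by <:].

Definition l2norm (f : l2 R V) : R[i] :=
  (Num.sqrt (fine (sqnorm (\val f))))%:C.

Lemma sqnorm_fin (f : l2 R V) : sqnorm (\val f) \is a fin_num.
Proof. by rewrite ge0_fin_numE ?sqnorm_ge0 //; apply/asboolP; exact: (valP f). Qed.

Fact l2norm_eq0 f : l2norm f = 0 -> f = 0.
Proof.
move=> /complexI/eqP; rewrite sqrtr_eq0 => f0.
apply/val_inj/sqnorm_eq0; rewrite -(fineK (sqnorm_fin f)); congr _%:E.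
by apply/eqP; rewrite eq_le f0 fine_ge0 ?sqnorm_ge0.
Qed.

Fact l2normZ (a : R[i]) f : l2norm (a *: f) = `|a| * l2norm f.
Proof.
rewrite /l2norm /= sqnormZ fineM ?sqnorm_fin //= sqrtrM ?sqr_ge0 //.
by rewrite sqrtr_sqr ger0_norm ?normc_ge0 // rmorphM.
Qed.

Fact ler_l2normD f g : l2norm (f + g) <= l2norm f + l2norm g.
Proof.
have [/l2norm_eq0 ->|f0] := eqVneq (l2norm f) 0.
  by rewrite add0r lerDr lecR sqrtr_ge0.
have [/l2norm_eq0 ->|g0] := eqVneq (l2norm g) 0.
  by rewrite addr0 lerDl lecR sqrtr_ge0.
rewrite /l2norm -rmorphD lecR.
move: f0 g0; rewrite /l2norm !(inj_eq (@complexI R) _ 0).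
set s := Num.sqrt (fine (sqnorm (\val f))).
set t := Num.sqrt (fine (sqnorm (\val g))) => s0 t0.
have sgt0 : 0 < s by rewrite lt0r s0 sqrtr_ge0.
have tgt0 : 0 < t by rewrite lt0r t0 sqrtr_ge0.
have := sqnormD (\val f) (\val g) sgt0 tgt0.
rewrite -[X in (X <= _)%E](fineK (sqnorm_fin (f + g))).
rewrite -(fineK (sqnorm_fin f)) -(fineK (sqnorm_fin g)) -!EFinM -EFinD lee_fin.
have -> : fine (sqnorm (\val f)) = s ^+ 2 by rewrite sqr_sqrtr ?fine_ge0 ?sqnorm_ge0.
have -> : fine (sqnorm (\val g)) = t ^+ 2 by rewrite sqr_sqrtr ?fine_ge0 ?sqnorm_ge0.
have -> : (s + t) / s * s ^+ 2 + (s + t) / t * t ^+ 2 = (s + t) ^+ 2.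
  by field; rewrite s0 t0.
move=> /ler_wsqrtr/le_trans; apply.
by rewrite sqrtr_sqr ger0_norm // addr_ge0 // ltW.
Qed.

HB.instance Definition _ :=
  Lmodule_isNormed.Build R[i] (l2 R V) ler_l2normD l2normZ l2norm_eq0.

End l2_module.

(* Unconditional sum of an absolutely summable family. *)
Definition rsum (R : realType) (V : choiceType) (h : V -> R) : R :=
  fine (\esum_(x in [set: V]) ((h^\+ x)%R)%:E) -
  fine (\esum_(x in [set: V]) ((h^\- x)%R)%:E).

Definition l2dot (R : realType) (V : choiceType) (f g : l2 R V) : R[i] :=
  let h := fun x => \val f x * (\val g x)^* in
  rsum (fun x => complex.Re (h x)) +i* rsum (fun x => complex.Im (h x)).

Lemma l2norm_sqr (R : realType) (V : choiceType) (f : l2 R V) :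
  `|f| ^+ 2 = l2dot f f.
Proof.
have hE x : \val f x * (\val f x)^* = (normc (\val f x) ^+ 2)%:C.
  by rewrite -sqr_normc rmorphXn.
rewrite -[LHS]rmorphXn /= sqr_sqrtr ?fine_ge0 ?sqnorm_ge0 //.
rewrite /l2dot (_ : (fun x => complex.Re _) = fun x => normc (\val f x) ^+ 2);
  last by apply/funext => x; rewrite hE.
rewrite (_ : (fun x => complex.Im _) = fun=> 0);
  last by apply/funext => x; rewrite hE.
rewrite /rsum /funrpos /funrneg /=; congr (_ +i* _).
  rewrite [X in _ - fine X]esum1 ?subr0; last first.
    by move=> x _; rewrite max_r // oppr_le0 sqr_ge0.
  by congr fine; apply: eq_esum => x _; rewrite max_l // sqr_ge0.
by rewrite !esum1 ?subrr // => x _; rewrite ?oppr0 maxxx.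
Qed.

Section delta.
Context {R : realType} {V : choiceType}.

Fact delta_subproof (x : V) :
  (fun y => (y == x)%:R : R[i]) \in (square_summable : {pred V -> R[i]}).
Proof.
apply/asboolP; rewrite /sqnorm (eq_esum (b := fun y => if y \in [set x] then 1%E else 0%E)).
  by rewrite -esum_mkcond esum_set1 // ltry.
move=> y _; have [->|/eqP yx] := eqVneq y x.
  by rewrite mem_set // normc1 expr1n.
by rewrite memNset // normc0 expr0n.
Qed.

Definition delta (x : V) : l2 R V :=
  exist (fun f : V -> R[i] => f \in square_summable) _ (delta_subproof x).

End delta.

Arguments delta R {V} x.

Section operators.
Context {K : numFieldType} {H : normedModType K}.

Definition lin (A : set H) : set H :=
  [set f | exists n (c : 'I_n -> K) (v : 'I_n -> H),
    (forall i, A (v i)) /\ f = \sum_(i < n) c i *: v i].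

(* Unbounded operators on H are given by their graphs, so that the closure of
   an operator is the topological closure of its graph in H * H. *)
Implicit Types T : set (H * H).

Definition eigenvector T (v : H) := v != 0 /\ exists z : K, T (v, z *: v).

(* T - z is a bijection from the domain of T onto H, with bounded inverse. *)
Definition resolvent_set T : set K :=
  [set z | (forall g, exists! f, T (f, g + z *: f)) /\
    exists M : K, forall f g, T (f, g + z *: f) -> `|f| <= M * `|g| ].

Definition spectrum T : set K := ~` resolvent_set T.

End operators.

Definition orthonormal_basis (R : realType) (V : choiceType)
    (B : set (l2 R V)) :=
  [/\ forall e, B e -> l2dot e e = 1,
      forall e e', B e -> B e' -> e <> e' -> l2dot e e' = 0 &
      closure (lin B) = [set: l2 R V]].

(* The sequence n |-> u_(n-1), with the convention u_(-1) = 0. *)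
Definition prev_term (M : nmodType) (u : nat -> M) (n : nat) : M :=
  if n is m.+1 then u m else 0.

Section jacobi.
Context {R : realType} {d : nat} {L : tree d}.
Variables lambda beta : nat -> R.

Definition jacobi_delta (x : L) : l2 R L :=
  (prev_term lambda (len x))%:C *: (\sum_(y \in succ @^-1` [set x]) delta R y) +
  (beta (len x))%:C *: delta R x + (lambda (len x))%:C *: delta R (succ x).

(* The sum is finite because f is finitely supported. *)
Definition jacobi : set (l2 R L * l2 R L) :=
  [set fg | lin (range (delta R)) fg.1 /\
    fg.2 = \sum_(x \in [set: L]) \val fg.1 x *: jacobi_delta x].

End jacobi.

(* Main.v *)
(** For a vertex z of length n >= 1 with predecessors z_1, ..., z_d, J acts on the functions
that are supported below z, constant on each level below each z_i, and of total sum 0 on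
every level, as the n x n Jacobi matrix A_n with diagonal beta_k and off-diagonal
sqrt d * lambda_k, tensored with the identity on the vectors of C^d of sum 0.
Diagonalising A_n gives orthonormal eigenvectors e(z,h,r) with eigenvalues the roots of
p_n.  They are total, even in the graph norm: the average of delta over the descendants
of succ^k y on the level of y equals delta_y for k = 0, its successive differences are
combinations of the e(z,h,r), and it tends to 0 together with its image under J.  Hence
the closure of J is the closure of its restriction to the span of the e(z,h,r), and its
spectrum is the closure of the set of eigenvalues. *)
From HB Require Import structures.
Require Import Defs.
From mathcomp Require Import all_boot all_order all_algebra.
From mathcomp Require Import complex ring lra zify spectral.
From mathcomp Require Import mathcomp_extra boolp classical_sets functions.
From mathcomp Require Import cardinality fsbigop reals ereal topology normedtype.
From mathcomp Require Import numfun esum sequences prodnormedzmodule.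
Set Implicit Arguments.
Unset Strict Implicit.
Unset Printing Implicit Defensive.
Import Order.TTheory GRing.Theory Num.Theory.
Import numFieldNormedType.Exports.
Import ComplexField.Normc.
Local Open Scope classical_set_scope.
Local Open Scope ring_scope.
Local Open Scope complex_scope.

(** * The inner product of l2 *)

(** Two cancellations shape the eigenvectors. Dividing a level sum by its norm, a power of sqrt d,
    balances the factor d that J produces in one direction against the factor 1 in the other: both
    become sqrt d, and the levels below one vertex carry a symmetric matrix. J still leaks out of
    the subtree at its top, into z. The leak is the same below each z_i, so coefficients of sum 0
    over i remove it and the finite matrix is exact. The same condition makes eigenvectors for
    different z orthogonal.

    All constructions take a module-valued function [D] on the vertices, so that each identity is
    proved once and read for delta, for J delta, and for the pair of both, a point of the graph.
    Approximating these pairs by eigenpairs works because an average of delta_y stays on the level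
    of y: only three fixed coefficients of J occur, while the norm decays like sqrt d to the power
    -k. *)

Section rsum_theory.
Context {R : realType} {V : choiceType}.
Implicit Types h : V -> R.

Definition abs_summable h := summable [set: V] (EFin \o h).

Lemma abs_summable_le h h' : (forall x, `|h x| <= `|h' x|) ->
  abs_summable h' -> abs_summable h.
Proof.
move=> hh'; apply: le_lt_trans; apply: le_esum => x _ /=.
by rewrite lee_fin.
Qed.

Lemma abs_summableD h1 h2 : abs_summable h1 -> abs_summable h2 ->
  abs_summable (h1 \+ h2).
Proof. by move=> s1 s2; exact: (summableD s1 s2). Qed.

Lemma abs_summableZ c h : abs_summable h -> abs_summable (fun x => c * h x).
Proof.
rewrite /abs_summable /summable => hs.
rewrite (eq_esum (b := fun x => (`|c|%:E * `|(EFin \o h) x|)%E)).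
  by rewrite ge0_esumZl // lte_mul_pinfty // lee_fin.
by move=> x _ /=; rewrite normrM EFinM.
Qed.

Lemma esum_EFin_fin h : (forall x, 0 <= h x) -> abs_summable h ->
  (\esum_(x in [set: V]) (h x)%:E)%E \is a fin_num.
Proof.
move=> h0; rewrite /abs_summable summableE; congr (_ \is a fin_num).
by apply: eq_esum => x _ /=; rewrite ger0_norm.
Qed.

Lemma abs_summable_pos h : abs_summable h -> abs_summable h^\+.
Proof.
apply: abs_summable_le => x; rewrite /funrpos ger0_norm ?le_max ?lexx ?orbT //.
by rewrite ge_max ler_norm normr_ge0.
Qed.

Lemma abs_summable_neg h : abs_summable h -> abs_summable h^\-.
Proof.
apply: abs_summable_le => x; rewrite /funrneg ger0_norm ?le_max ?lexx ?orbT //.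
by rewrite ge_max normr_ge0 -normrN ler_norm.
Qed.

(** Positive and negative parts are not additive, so additivity of [rsum] requires computing it from
    an arbitrary splitting into nonnegative summable functions, not only the canonical one. *)
Lemma rsumB h1 h2 : (forall x, 0 <= h1 x) -> (forall x, 0 <= h2 x) ->
  abs_summable h1 -> abs_summable h2 ->
  rsum (h1 \- h2) = fine (\esum_(x in [set: V]) (h1 x)%:E)%E -
                    fine (\esum_(x in [set: V]) (h2 x)%:E)%E.
Proof.
move=> h10 h20 s1 s2.
have s12 : abs_summable (h1 \- h2).
  apply: abs_summable_le (abs_summableD s1 s2) => x /=.
  by rewrite (le_trans (ler_normB _ _)) // !ger0_norm // addr_ge0.
apply: EFin_inj.
have fp q0 := esum_EFin_fin q0 (abs_summable_pos s12).
have fn q0 := esum_EFin_fin q0 (abs_summable_neg s12).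
rewrite /rsum !EFinB !fineK; last 4 first.
- exact: esum_EFin_fin.
- exact: esum_EFin_fin.
- by apply: fn => x; rewrite /funrneg le_max lexx orbT.
- by apply: fp => x; rewrite /funrpos le_max lexx orbT.
rewrite -(esumB (f := EFin \o h1) (g := EFin \o h2)) //; last 2 first.
- by move=> x _ /=; rewrite lee_fin.
- by move=> x _ /=; rewrite lee_fin.
by congr (_ - _)%E; apply: eq_esum => x _; rewrite ?funeposE ?funenegE /funrpos /funrneg /=
  -?EFinB -?EFinN EFin_max.
Qed.

Lemma rsumD h1 h2 : abs_summable h1 -> abs_summable h2 ->
  rsum (fun x => h1 x + h2 x) = rsum h1 + rsum h2.
Proof.
move=> s1 s2.
have p1 := abs_summable_pos s1; have n1 := abs_summable_neg s1.
have p2 := abs_summable_pos s2; have n2 := abs_summable_neg s2.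
have pos h x : 0 <= h^\+ x by rewrite /funrpos le_max lexx orbT.
have neg h x : 0 <= h^\- x by rewrite /funrneg le_max lexx orbT.
have esD f g : (forall x, 0 <= f x) -> (forall x, 0 <= g x) ->
    abs_summable f -> abs_summable g ->
    fine (\esum_(x in [set: V]) ((f \+ g) x)%:E)%E =
    fine (\esum_(x in [set: V]) (f x)%:E)%E + fine (\esum_(x in [set: V]) (g x)%:E)%E.
  move=> f0 g0 sf sg; rewrite -fineD ?esum_EFin_fin //.
  by rewrite -esumD // => x _; rewrite lee_fin.
rewrite (_ : (fun x => _) = (h1^\+ \+ h2^\+) \- (h1^\- \+ h2^\-)); last first.
  apply/funext => x; rewrite /funrpos /funrneg /=.
  have E a : a = Num.max a 0 - Num.max (- a) 0 :> R.
    by have [a0|a0] := leP 0 a; [rewrite max_r ?oppr_le0 // subr0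
      | rewrite max_l ?oppr_ge0 ?(ltW a0) // sub0r opprK].
  by rewrite {1}(E (h1 x)) {1}(E (h2 x)); ring.
rewrite rsumB ?esD /rsum //; first by ring.
- by move=> x /=; rewrite addr_ge0.
- by move=> x /=; rewrite addr_ge0.
- exact: abs_summableD.
- exact: abs_summableD.
Qed.

Lemma rsumN h : rsum (fun x => - h x) = - rsum h.
Proof.
rewrite /rsum opprB; congr (fine _ - fine _); apply: eq_esum => x _.
by rewrite /funrpos /funrneg opprK.
Qed.

Lemma rsumZ c h : abs_summable h -> rsum (fun x => c * h x) = c * rsum h.
Proof.
move=> hs; wlog c0 : c / 0 <= c => [W|].
  have [c0|c0] := leP 0 c; first exact: W.
  have -> : (fun x => c * h x) = fun x => - (- c * h x).
    by apply/funext => x; rewrite mulNr opprK.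
  by rewrite rsumN W ?oppr_ge0 ?(ltW c0) // mulNr opprK.
have key (f : V -> R) : (forall x, 0 <= f x) ->
   fine (\esum_(x in [set: V]) (c * f x)%:E)%E =
   c * fine (\esum_(x in [set: V]) (f x)%:E)%E.
  move=> f0; transitivity (fine (c%:E * \esum_(x in [set: V]) (f x)%:E)%E).
    by rewrite -ge0_esumZl // => x; rewrite lee_fin.
  have [->|cn0] := eqVneq c 0; first by rewrite mul0e mul0r.
  (* An infinite sum stays infinite after multiplication by [c > 0], and [fine] sends it to 0 on
     both sides. *)
  case: (\esum_(x in [set: V]) _)%E => [r||] //=.
    by rewrite mulry gtr0_sg ?lt0r ?cn0 // mul1e /= mulr0.
  by rewrite mulrNy gtr0_sg ?lt0r ?cn0 // mul1e /= mulr0.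
rewrite /rsum mulrBr -!key; last 2 first.
- by move=> x; rewrite /funrneg le_max lexx orbT.
- by move=> x; rewrite /funrpos le_max lexx orbT.
congr (fine _ - fine _); apply: eq_esum => x _; congr _%:E.
  by rewrite /funrpos maxr_pMr // mulr0.
by rewrite /funrneg -mulrN maxr_pMr // mulr0.
Qed.

End rsum_theory.

Section l2dot_theory.
Context {R : realType} {V : choiceType}.
Implicit Types f g : l2 R V.

Lemma abs_summable_sq f : abs_summable (fun x => normc (\val f x) ^+ 2).
Proof.
have /asboolP := valP f; rewrite /abs_summable /summable /sqnorm.
apply: le_lt_trans; apply: le_esum => x _ /=.
by rewrite ger0_norm // sqr_ge0.
Qed.

Lemma normc_Re_Im (z : R[i]) :
  `|complex.Re z| <= normc z /\ `|complex.Im z| <= normc z.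
Proof.
case: z => a b; split; rewrite /= -sqrtr_sqr ler_wsqrtr //.
  by rewrite lerDl sqr_ge0.
by rewrite lerDr sqr_ge0.
Qed.

Lemma normc_conj (z : R[i]) : normc z^* = normc z.
Proof. by case: z => a b /=; rewrite sqrrN. Qed.

(** The product is dominated by the sum of the squared moduli, since 2ab is at most a^2 + b^2. *)
Lemma l2dot_summable f g :
  abs_summable (fun x => complex.Re (\val f x * (\val g x)^*)) /\
  abs_summable (fun x => complex.Im (\val f x * (\val g x)^*)).
Proof.
have s := abs_summableD (abs_summable_sq f) (abs_summable_sq g).
have b x : normc (\val f x * (\val g x)^*) <=
    `|normc (\val f x) ^+ 2 + normc (\val g x) ^+ 2|.
  rewrite normcM normc_conj ger0_norm ?addr_ge0 ?sqr_ge0 //.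
  have := sqr_ge0 (normc (\val f x) - normc (\val g x)).
  have := mulr_ge0 (normc_ge0 (\val f x)) (normc_ge0 (\val g x)).
  move: (normc _) (normc _) => a c; nra.
split; apply: abs_summable_le s => x; apply: le_trans (b x);
  by have [] := normc_Re_Im (\val f x * (\val g x)^*).
Qed.

Lemma l2dotDl f f' g : l2dot (f + f') g = l2dot f g + l2dot f' g.
Proof.
have [s1 s2] := l2dot_summable f g; have [s1' s2'] := l2dot_summable f' g.
apply/eqP; rewrite eq_complex /l2dot /= -!rsumD //; apply/andP; split.
  by apply/eqP; congr rsum; apply/funext => x; rewrite /= mulrDl raddfD.
by apply/eqP; congr rsum; apply/funext => x; rewrite /= mulrDl raddfD.
Qed.

Lemma l2dotZl c f g : l2dot (c *: f) g = c * l2dot f g.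
Proof.
have [s1 s2] := l2dot_summable f g; case: c => a b.
rewrite /l2dot; simpc; rewrite -mulNr -!rsumZ // -!rsumD; last 4 first.
- exact: abs_summableZ.
- exact: abs_summableZ.
- exact: abs_summableZ.
- exact: abs_summableZ.
congr (_ +i* _); congr rsum; apply/funext => x;
  rewrite -mulrA /=; move: (\val f x * _) => [u v] /=; ring.
Qed.

Lemma l2dotC f g : l2dot f g = (l2dot g f)^*.
Proof.
rewrite /l2dot /= -rsumN; congr (_ +i* _); congr rsum; apply/funext => x;
  move: (\val f x) (\val g x) => [a b] [c e] /=; ring.
Qed.

Lemma l2dotDr f g g' : l2dot f (g + g') = l2dot f g + l2dot f g'.
Proof. by rewrite l2dotC l2dotDl (l2dotC f g) (l2dotC f g') rmorphD. Qed.

Lemma l2dotZr c f g : l2dot f (c *: g) = c^* * l2dot f g.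
Proof. by rewrite l2dotC l2dotZl (l2dotC f g) rmorphM. Qed.

Lemma l2dot0l g : l2dot 0 g = 0.
Proof. by rewrite -(scale0r 0) l2dotZl mul0r. Qed.

Lemma l2dot0r g : l2dot g 0 = 0.
Proof. by rewrite l2dotC l2dot0l rmorph0. Qed.

Lemma l2dot_suml (I : Type) (r : seq I) (P : pred I) (F : I -> l2 R V) g :
  l2dot (\sum_(i <- r | P i) F i) g = \sum_(i <- r | P i) l2dot (F i) g.
Proof. by elim/big_rec2: _ => [|i y1 y2 _ <-]; rewrite ?l2dot0l ?l2dotDl. Qed.

Lemma l2dot_sumr (I : Type) (r : seq I) (P : pred I) (F : I -> l2 R V) g :
  l2dot g (\sum_(i <- r | P i) F i) = \sum_(i <- r | P i) l2dot g (F i).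
Proof. by elim/big_rec2: _ => [|i y1 y2 _ <-]; rewrite ?l2dot0r ?l2dotDr. Qed.

Lemma l2dot_delta f x : l2dot f (delta R x) = \val f x.
Proof.
have E (h : V -> R) : (forall y, y != x -> h y = 0) -> rsum h = h x.
  move=> h0; have E' (k : V -> R) : (forall y, y != x -> k y = 0) ->
      (forall y, 0 <= k y) -> fine (\esum_(y in [set: V]) (k y)%:E)%E = k x.
    move=> k0 kge0; rewrite (eq_esum (b := fun y => if y \in [set x] then (k y)%:E else 0%E)).
      by rewrite -esum_mkcond esum_set1 // lee_fin.
    move=> y _; have [/set_mem ->//|yx] := boolP (y \in [set x]).
    by rewrite k0 //; apply: contra yx => /eqP ->; rewrite inE.
  rewrite /rsum !E' /funrpos /funrneg ?le_max ?lexx ?orbT //.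
  - have [a0|a0] := leP 0 (h x); first by rewrite max_r ?oppr_le0 // subr0.
    by rewrite max_l ?oppr_ge0 ?(ltW a0) // sub0r opprK.
  - by move=> y /h0 ->; rewrite oppr0 maxxx.
  - by move=> y; rewrite le_max lexx orbT.
  - by move=> y /h0 ->; rewrite maxxx.
  - by move=> y; rewrite le_max lexx orbT.
have Ef y : \val f y * (\val (delta R x) y)^* = if y == x then \val f y else 0.
  rewrite /=; case: (y == x); last by rewrite [X in _ * X]rmorph0 mulr0.
  by rewrite [X in _ * X]rmorph1 mulr1.
rewrite /l2dot !E ?Ef ?eqxx; first by case: (\val f x).
  by move=> y /negbTE yx; rewrite Ef yx.
by move=> y /negbTE yx; rewrite Ef yx.
Qed.

Lemma normc_normE (z : R[i]) : `|z| = (normc z)%:C.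
Proof. by []. Qed.

Lemma coord_le_norm f x : `|\val f x| <= `|f|.
Proof.
rewrite normc_normE [leRHS]/(l2norm f) /l2norm lecR.
rewrite -[normc _]ger0_norm ?normc_ge0 // -sqrtr_sqr ler_wsqrtr //.
rewrite -lee_fin fineK ?sqnorm_fin //.
apply: esum_ge; exists [set x]; first by split.
by rewrite fsbig_set1.
Qed.

Lemma coord_sum (I : Type) (r : seq I) (P : pred I) (F : I -> l2 R V) x :
  \val (\sum_(i <- r | P i) F i) x = \sum_(i <- r | P i) \val (F i) x.
Proof. by rewrite -l2dot_delta l2dot_suml; apply: eq_bigr => i _; rewrite l2dot_delta. Qed.

End l2dot_theory.

(** * Subspaces, completeness and density *)

Section subspaces.
Context {K : numFieldType} {H : normedModType K}.
Implicit Types (A S : set H) (f g : H).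

Definition subspace S := S 0 /\ forall (c : K) f g, S f -> S g -> S (c *: f + g).

Lemma subspaceD S f g : subspace S -> S f -> S g -> S (f + g).
Proof. by move=> [_ lS] Sf Sg; rewrite -[f]scale1r; exact: lS. Qed.

Lemma subspaceZ S c f : subspace S -> S f -> S (c *: f).
Proof. by move=> [S0 lS] Sf; rewrite -[_ *: _]addr0; exact: lS. Qed.

Lemma subspaceB S f g : subspace S -> S f -> S g -> S (f - g).
Proof. by move=> lS Sf Sg; rewrite addrC -scaleN1r; exact: (proj2 lS). Qed.

Lemma subspace_sum S (I : Type) (r : seq I) (P : pred I) (F : I -> H) :
  subspace S -> (forall i, P i -> S (F i)) -> S (\sum_(i <- r | P i) F i).
Proof.
move=> lS SF; elim/big_rec: _ => [|i f Pi Sf]; first by case: lS.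
exact: subspaceD (SF i Pi) Sf.
Qed.

Lemma lin_subspace A : subspace (lin A).
Proof.
split.
  exists 0%N, (fun=> 0), (fun=> 0); split; first by case.
  by rewrite big_ord0.
move=> c _ _ [n [a [v [Av ->]]]] [m [b [w [Aw ->]]]].
exists (n + m)%N, (fun i => match fintype.split i with inl j => c * a j | inr k => b k end),
  (fun i => match fintype.split i with inl j => v j | inr k => w k end).
split; first by move=> i; case: fintype.split.
rewrite big_split_ord scaler_sumr; congr (_ + _); apply: eq_bigr => i _.
  by rewrite -/(unsplit (inl i)) unsplitK scalerA.
by rewrite -/(unsplit (inr i)) unsplitK.
Qed.

Lemma sub_lin A : A `<=` lin A.
Proof.
move=> f Af; exists 1%N, (fun=> 1), (fun=> f); split=> //.
by rewrite big_ord1 scale1r.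
Qed.

Lemma lin_min A S : subspace S -> A `<=` S -> lin A `<=` S.
Proof.
move=> lS AS _ [n [c [v [Av ->]]]]; apply: subspace_sum => // i _.
exact: (subspaceZ _ lS (AS _ (Av i))).
Qed.

Lemma closure_normP S f :
  closure S f <-> forall e, 0 < e -> exists2 g, S g & `|f - g| < e.
Proof.
split=> [cf e e0|Sf B].
  have [g [Sg fg]] := cf _ (nbhsx_ballx f (PosNum e0)%:num (gt0 _)).
  by exists g => //; move: fg; rewrite -ball_normE.
move=> /nbhs_ballP[e e0 eB]; have [g Sg fg] := Sf e e0.
by exists g; split=> //; apply: eB; rewrite -ball_normE.
Qed.

Lemma closure_subspace S : subspace S -> subspace (closure S).
Proof.
move=> lS; split; first by apply: subset_closure; case: lS.
move=> c f g /closure_normP cf /closure_normP cg; apply/closure_normP => e e0.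
have c0 : 0 < `|c| + 1 by rewrite ltr_wpDl.
have e1 : 0 < e / 2 / (`|c| + 1) by rewrite !divr_gt0.
have e2 : 0 < e / 2 by rewrite divr_gt0.
have [f' Sf' ff'] := cf _ e1; have [g' Sg' gg'] := cg _ e2.
exists (c *: f' + g'); first by case: lS => _; apply.
have -> : c *: f + g - (c *: f' + g') = c *: (f - f') + (g - g').
  by rewrite scalerBr opprD addrACA.
apply: le_lt_trans (ler_normD _ _) _; rewrite normrZ [e]splitr.
apply: ler_ltD gg'; move: ff'; rewrite ltr_pdivlMr // => /ltW; apply: le_trans.
by rewrite mulrC ler_wpM2l // lerDl.
Qed.

Lemma closure_lin_min A S : subspace S -> A `<=` closure S ->
  closure (lin A) `<=` closure S.
Proof.
move=> lS AS; rewrite [X in _ `<=` X](proj1 (closure_id _) (@closed_closure _ S)).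
by apply: closure_subset; apply: lin_min => //; exact: closure_subspace.
Qed.

Lemma big_uniq_widen (I : eqType) (s t : seq I) (F : I -> H) :
  uniq s -> uniq t -> {subset s <= t} ->
  \sum_(a <- s) F a = \sum_(a <- t) (if a \in s then F a else 0).
Proof.
move=> us ut st; rewrite -big_mkcond -big_filter; apply: perm_big.
apply: uniq_perm => //; first by rewrite filter_uniq.
by move=> a; rewrite mem_filter andb_idr //; exact: st.
Qed.

(** The families in [lin] may repeat a vector. Distinct indices are what Pythagoras and the reading
    of coordinates need. *)
Lemma lin_range_uniq (I : eqType) (G : I -> H) f : lin (range G) f ->
  exists s (c : I -> K), uniq s /\ f = \sum_(a <- s) c a *: G a.
Proof.
apply: (lin_min (S := fun f => exists s (c : I -> K),
  uniq s /\ f = \sum_(a <- s) c a *: G a)) => {f}; last first.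
  move=> _ [a _ <-]; exists [:: a], (fun=> 1); split=> //.
  by rewrite big_seq1 scale1r.
split; first by exists [::], (fun=> 0); rewrite big_nil.
move=> c _ _ [s [a [us ->]]] [t [b [ut ->]]].
exists (undup (s ++ t)), (fun x => (if x \in s then c * a x else 0) +
  (if x \in t then b x else 0)); split; first exact: undup_uniq.
rewrite scaler_sumr (big_uniq_widen _ us (undup_uniq (s ++ t))); last first.
  by move=> x xs; rewrite mem_undup mem_cat xs.
rewrite (big_uniq_widen _ ut (undup_uniq (s ++ t))); last first.
  by move=> x xs; rewrite mem_undup mem_cat xs orbT.
rewrite -big_split; apply: eq_bigr => x _ /=; rewrite scalerDl.
by congr (_ + _); case: ifP => _; rewrite ?scalerA ?scale0r.
Qed.

End subspaces.

Section l2_complete.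
Context {R : realType} {V : choiceType}.

Lemma cauchy_rate_cvg (a eps : R^nat) :
  (forall n m, (n <= m)%N -> `|a n - a m| <= eps n) -> eps @ \oo --> 0 ->
  a @ \oo --> limn a.
Proof.
move=> aeps eps0; apply: cauchy_cvg; apply: cauchy_exP => e e0.
have /cvgrPdist_lt/(_ e e0)[N _ /(_ N (leqnn N))] := eps0.
rewrite /= sub0r normrN => Ne; exists (a N); exists N => // m Nm.
rewrite /= -ball_normE /=; apply: le_lt_trans (aeps _ _ Nm) _.
exact: le_lt_trans (ler_norm _) Ne.
Qed.

Lemma sqnorm_le (h : V -> R[i]) (M : R) :
  (forall s : seq V, uniq s -> \sum_(x <- s) normc (h x) ^+ 2 <= M) ->
  (sqnorm h <= M%:E)%E.
Proof.
move=> hM; apply: ub_ereal_sup => _ [A [fA _] <-].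
rewrite fsbig_finite //= sumEFin lee_fin; apply: hM; exact: finmap.fset_uniq.
Qed.

Lemma sqnorm_ge (h : V -> R[i]) (s : seq V) : uniq s ->
  ((\sum_(x <- s) normc (h x) ^+ 2)%:E <= sqnorm h)%E.
Proof.
move=> us; apply: esum_ge; exists [set` s]; first by split.
by rewrite -fsbig_seq // sumEFin.
Qed.

(** The limit is taken coordinatewise, in real and imaginary parts. On finitely many coordinates the
    bound passes to the limit in [m]; the supremum over finite sets then bounds [sqnorm]. The limit
    is square summable because [u 0] and [u 0 - F] are. *)
Lemma l2_complete (u : nat -> l2 R V) (eps : R^nat) :
  (forall n m, (n <= m)%N -> `|u n - u m| <= (eps n)%:C) -> eps @ \oo --> 0 ->
  exists f, forall n, `|u n - f| <= (eps n)%:C.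
Proof.
move=> ueps eps0.
have coord n m x : (n <= m)%N -> normc (\val (u n) x - \val (u m) x) <= eps n.
  move=> nm; rewrite -lecR -normc_normE.
  exact: le_trans (coord_le_norm (u n - u m) x) (ueps _ _ nm).
pose F x : R[i] := limn (fun n => complex.Re (\val (u n) x)) +i*
                   limn (fun n => complex.Im (\val (u n) x)).
have cRe x : (fun n => complex.Re (\val (u n) x)) @ \oo --> complex.Re (F x).
  apply: (cauchy_rate_cvg _ eps0) => n m nm; rewrite -raddfB.
  exact: le_trans (proj1 (normc_Re_Im _)) (coord _ _ _ nm).
have cIm x : (fun n => complex.Im (\val (u n) x)) @ \oo --> complex.Im (F x).
  apply: (cauchy_rate_cvg _ eps0) => n m nm; rewrite -raddfB.
  exact: le_trans (proj2 (normc_Re_Im _)) (coord _ _ _ nm).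
have normE (z : R[i]) : normc z ^+ 2 = complex.Re z ^+ 2 + complex.Im z ^+ 2.
  by case: z => a b; rewrite /= sqr_sqrtr // addr_ge0 ?sqr_ge0.
have eps_ge0 n : 0 <= eps n.
  by have := ueps n n (leqnn n); rewrite subrr normr0 ler0c.
have bound n : (sqnorm ((\val (u n) : V -> R[i]) - F)%R <= (eps n ^+ 2)%:E)%E.
  apply: sqnorm_le => s us.
  apply: (cvgr_to_le (F := \oo)
    (f := fun m => \sum_(x <- s) normc (\val (u n) x - \val (u m) x) ^+ 2)).
    elim: s {us} => [|x s IHs].
      by under eq_fun do rewrite big_nil; rewrite big_nil; exact: cvg_cst.
    under eq_fun do rewrite big_cons; rewrite big_cons; apply: cvgD IHs.
    have c1 : (fun m => complex.Re (\val (u n) x) - complex.Re (\val (u m) x)) @ \oo -->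
        complex.Re (\val (u n) x) - complex.Re (F x).
      by apply: cvgB (cRe x); exact: cvg_cst.
    have c2 : (fun m => complex.Im (\val (u n) x) - complex.Im (\val (u m) x)) @ \oo -->
        complex.Im (\val (u n) x) - complex.Im (F x).
      by apply: cvgB (cIm x); exact: cvg_cst.
    have subE (z w : R[i]) : normc (z - w) ^+ 2 =
        (complex.Re z - complex.Re w) * (complex.Re z - complex.Re w) +
        (complex.Im z - complex.Im w) * (complex.Im z - complex.Im w).
      by rewrite normE -!expr2; case: z w => [a b] [a' b'].
    under eq_fun do rewrite subE; rewrite [X in nbhs X](subE (\val (u n) x) (F x)).
    exact: cvgD (cvgM c1 c1) (cvgM c2 c2).
  exists n => // m nm /=; rewrite -lee_fin.
  apply: le_trans (sqnorm_ge (\val (u n - u m)) us) _.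
  rewrite -(fineK (sqnorm_fin (u n - u m))) lee_fin.
  have := ueps _ _ nm; rewrite [X in X <= _]/(l2norm _) lecR => h.
  by rewrite -(ler_sqrt _ (sqr_ge0 _)) sqrtr_sqr ger0_norm.
have dl2 : ((\val (u 0%N) : V -> R[i]) - F) \in square_summable.
  by apply/asboolP; apply: le_lt_trans (bound 0%N) _; rewrite ltry.
have Fl2 : F \in square_summable.
  have -> : F = \val (u 0%N) - ((\val (u 0%N) : V -> R[i]) - F) by rewrite subKr.
  by apply: rpredB => //; exact: valP.
exists (exist _ F Fl2) => n; rewrite [X in X <= _]/(l2norm _) lecR.
rewrite -[leRHS]ger0_norm // -sqrtr_sqr ler_sqrt ?sqr_ge0 // -lee_fin fineK ?sqnorm_fin //.
exact: bound.
Qed.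

Lemma coord_Zdelta (c : R[i]) (x y : V) :
  \val (c *: delta R y) x = if x == y then c else 0.
Proof.
rewrite -[LHS]/(c * (x == y)%:R); case: (x == y); first exact: mulr1.
exact: mulr0.
Qed.

Lemma closure_lin_delta : closure (lin (range (delta R))) = [set: l2 R V].
Proof.
apply/seteqP; split=> // f _; apply/closure_normP => e e0.
(* In the partial order of [R[i]], [0 < e] forces [e] to be real; the estimate is then carried out
   with its real part. *)
have re0 : 0 < complex.Re e by move: e0; rewrite ltcE => /andP[].
have eE : e = (complex.Re e)%:C.
  by move: e0; case: (e) => a b; rewrite ltcE => /andP[/eqP /= -> _].
have fE : (sqnorm (\val f) - (complex.Re e ^+ 2)%:E < sqnorm (\val f))%E.
  by rewrite -(fineK (sqnorm_fin f)) -EFinB lte_fin ltrBlDr ltrDl exprn_gt0.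
have := fE; rewrite {2}/sqnorm /esum => /ereal_sup_gt[_ [A [fA _] <-]].
rewrite fsbig_finite //= sumEFin; set s := finmap.enum_fset (fset_set A).
rewrite -(fineK (sqnorm_fin f)) -EFinB lte_fin => sE.
exists (\sum_(x <- s) \val f x *: delta R x).
  apply: (subspace_sum (S := lin _)) => [|x _]; first exact: lin_subspace.
  by apply: subspaceZ; [exact: lin_subspace|apply: sub_lin; exists x].
set g := \sum_(x <- s) _.
have gE x : \val g x = if x \in s then \val f x else 0.
  rewrite coord_sum; under eq_bigr do rewrite coord_Zdelta.
  have [xs|xs] := ifP.
    rewrite (bigD1_seq x) //= ?finmap.fset_uniq // eqxx big1 ?addr0 // => y yx.
    by rewrite eq_sym (negbTE yx).
  rewrite big_seq big1 // => y ys.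
  by case: eqVneq => [xy|//]; rewrite -xy xs in ys.
have dotE h : l2dot h g = \sum_(x <- s) (\val f x)^* * \val h x.
  by rewrite l2dot_sumr; apply: eq_bigr => x _; rewrite l2dotZr l2dot_delta.
have fg0 : l2dot (f - g) g = 0.
  rewrite dotE big_seq big1 // => x xs.
  by rewrite [X in _ * X](_ : _ = \val f x - \val g x) // gE xs subrr mulr0.
(* The truncation [g] is orthogonal to [f - g], so the squared error is the part of [sqnorm] missed
   by [s], which is less than the square of [e] by the choice of [s]. *)
have pyth : `|f| ^+ 2 = `|f - g| ^+ 2 + `|g| ^+ 2.
  have fgE : f = (f - g) + g by rewrite subrK.
  move: (f - g) fg0 fgE => h hg0 fE'.
  by rewrite !l2norm_sqr fE' l2dotDl !l2dotDr hg0 (l2dotC g) hg0 rmorph0 addr0 add0r.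
have g2 : `|g| ^+ 2 = (\sum_(x <- s) normc (\val f x) ^+ 2)%:C.
  rewrite l2norm_sqr dotE rmorph_sum /= big_seq [RHS]big_seq; apply: eq_bigr => x xs.
  by rewrite gE xs mulrC -sqr_normc normc_normE rmorphXn.
have f2 : `|f| ^+ 2 = (fine (sqnorm (\val f)))%:C.
  by rewrite -[LHS]rmorphXn /= sqr_sqrtr ?fine_ge0 ?sqnorm_ge0.
rewrite -(ltr_pXn2r (n := 2)) ?nnegrE ?(ltW e0) //.
rewrite -[X in X < _](addrK (`|g| ^+ 2)) -pyth f2 g2 eE -rmorphXn -rmorphB ltcR.
by rewrite ltrBlDr addrC -ltrBlDr.
Qed.

End l2_complete.

(** * Level sums on the tree *)

Section tree_sums.
Context {d : nat} {L : tree d}.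
Implicit Types (x y : L) (k m : nat).

(** The condition on the length stands inside the existential, so an enumeration can be chosen at
    every vertex and [pr] takes no proof as argument; at length 0 its values are dummies. *)
Lemma pred_enum_exists x : exists f : nat -> L,
  (1 <= len x)%N -> set_bij `I_d (succ @^-1` [set x]) f.
Proof.
have [x1|x0] := leqP 1 (len x); last by exists (fun=> x).
pose U : pointedType := HB.pack (vertex L) (isPointed.Build (vertex L) x).
have /(@card_set_bijP _ U)[f fb] : (`I_d #= succ @^-1` [set x])%card.
  by rewrite card_eq_sym; exact: card_preds.
by exists f.
Qed.

Definition pr x (i : 'I_d) : L := projT1 (cid (pred_enum_exists x)) i.

Lemma pr_bij x : (1 <= len x)%N ->
  set_bij `I_d (succ @^-1` [set x]) (projT1 (cid (pred_enum_exists x))).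
Proof. by case: cid. Qed.

Lemma succ_pr x i : (1 <= len x)%N -> succ (pr x i) = x.
Proof. by move=> /pr_bij[/(_ i (ltn_ord i))]. Qed.

Lemma len_pr x i : (1 <= len x)%N -> (len (pr x i)).+1 = len x.
Proof. by move=> x1; rewrite -len_succ succ_pr. Qed.

Lemma pr_inj x : (1 <= len x)%N -> injective (pr x).
Proof.
move=> /pr_bij[_ inj _] i j ij; by apply/val_inj/inj; rewrite ?inE //=.
Qed.

Lemma pr_surj y : exists i, pr (succ y) i = y.
Proof.
have [|_ _ /(_ y erefl)[k kd ky]] := pr_bij (x := succ y); first by rewrite len_succ.
by exists (Ordinal kd).
Qed.

Lemma sum_preds (M : nmodType) (F : L -> M) x : (1 <= len x)%N ->
  \sum_(y \in succ @^-1` [set x]) F y = \sum_(i < d) F (pr x i).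
Proof.
move=> x1; rewrite (reindex_fsbig (projT1 (cid (pred_enum_exists x))) `I_d).
  by rewrite -fsbig_ord.
exact: pr_bij.
Qed.

Lemma pr_indicator (K : pzRingType) x y : (1 <= len x)%N ->
  \sum_(i < d) (y == pr x i)%:R = (succ y == x)%:R :> K.
Proof.
move=> x1; have [yx|/eqP yx] := eqVneq (succ y) x.
  have [i yi] := pr_surj y; rewrite yx in yi.
  rewrite (bigD1 i) //= -{1}yi eqxx big1 ?addr0 // => j ji.
  by rewrite -yi (inj_eq (pr_inj x1)) eq_sym (negbTE ji).
rewrite big1 // => i _; have [yi|//] := eqVneq y (pr x i).
by case: yx; rewrite yi succ_pr.
Qed.

Lemma len_iter_succ k y : len (iter k succ y) = (k + len y)%N.
Proof. by elim: k => // k IHk; rewrite iterS len_succ IHk. Qed.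

Section level_sum.
Context {M : nmodType}.
Implicit Types D : L -> M.

(* The sum of D over the descendants of x at depth k (k <= len x). *)
Fixpoint lsum D k x : M :=
  if k is k'.+1 then \sum_(i < d) lsum D k' (pr x i) else D x.

End level_sum.

(** Meant for the projections [fst] and [snd]: it splits a level sum of graph points into the sum of
    the vectors and the sum of their images. *)
Lemma lsum_morph (M M' : nmodType) (phi : M -> M') (D : L -> M) k x :
  phi 0 = 0 -> {morph phi : u v / u + v} -> phi (lsum D k x) = lsum (phi \o D) k x.
Proof.
move=> phi0 phiD; elim: k x => //= k IHk x.
rewrite (big_morph phi phiD phi0).
by apply: eq_bigr => i _; rewrite IHk.
Qed.

Context {R : realType}.

Lemma lsum_delta_val k x y : (k <= len x)%N ->
  \val (lsum (delta R) k x) y = (iter k succ y == x)%:R.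
Proof.
elim: k x => [|k IHk] x kx //=.
have x1 : (1 <= len x)%N by apply: leq_trans kx.
rewrite -(pr_indicator _ (iter k succ y)) // coord_sum.
by apply: eq_bigr => i _; rewrite IHk // -ltnS len_pr.
Qed.

(** Both sums live on the same level. The descendants of [x] there are all below [x'] or all outside
    it, and there are d^k of them. *)
Lemma dot_lsum k m x x' : (k <= len x)%N -> len x' = (m + len x)%N ->
  l2dot (lsum (delta R) (m + k) x') (lsum (delta R) k x) =
  d%:R ^+ k * (iter m succ x == x')%:R.
Proof.
elim: k m x => [|k IHk] m x kx lx'.
  by rewrite addn0 /= l2dot_delta lsum_delta_val ?lx' ?leq_addr // expr0 mul1r.
have x1 : (1 <= len x)%N by apply: leq_trans kx.
rewrite [lsum _ k.+1 x]/= l2dot_sumr.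
rewrite (eq_bigr (fun=> d%:R ^+ k * (iter m succ x == x')%:R)) => [|i _].
  by rewrite sumr_const card_ord -[LHS]mulr_natl exprS mulrA.
rewrite addnS -addSn IHk; first by rewrite iterSr succ_pr.
  by rewrite -ltnS len_pr.
by rewrite lx' -(len_pr i x1) addnS.
Qed.

(** The inequality says, without subtraction, that the levels [len x - k] and [len x' - k'] differ;
    the supports are then disjoint. *)
Lemma dot_lsum0 k k' x x' : (k <= len x)%N -> (k' <= len x')%N ->
  (k' + len x)%N <> (k + len x')%N ->
  l2dot (lsum (delta R) k' x') (lsum (delta R) k x) = 0.
Proof.
elim: k x => [|k IHk] x kx kx' ne.
  rewrite /= l2dot_delta lsum_delta_val //; case: eqP => // E.
  by case: ne; rewrite -len_iter_succ E.
have x1 : (1 <= len x)%N by apply: leq_trans kx.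
rewrite [lsum _ k.+1 x]/= l2dot_sumr big1 // => i _.
apply: IHk => //; first by rewrite -ltnS len_pr.
by move=> E; apply: ne; rewrite -(len_pr i x1) addnS E.
Qed.

Variables lambda beta : nat -> R.

(* What J sends the sum over depth k to one level up: the sum over depth k - 1,
   counted d times, or for k = 0 the successor of x. *)
Definition lsum_up k x : l2 R L :=
  if k is k'.+1 then d%:R *: lsum (delta R) k' x else delta R (succ x).

(** All summands have length [len x - k], so they share their coefficients and J acts on level sums
    by three terms; the factor d in [lsum_up] keeps this from being symmetric before rescaling. *)
Lemma lsum_jacobi k x : (k <= len x)%N ->
  lsum (jacobi_delta lambda beta) k x =
    (prev_term lambda (len x - k))%:C *: lsum (delta R) k.+1 x +
    (beta (len x - k))%:C *: lsum (delta R) k x +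
    (lambda (len x - k))%:C *: lsum_up k x.
Proof.
elim: k x => [|k IHk] x kx.
  rewrite subn0 /= /jacobi_delta; case E : (len x) => [|l]; first by rewrite !scale0r.
  by rewrite sum_preds ?E.
have x1 : (1 <= len x)%N by apply: leq_trans kx.
rewrite [LHS]/= (eq_bigr (fun i =>
    (prev_term lambda (len x - k.+1))%:C *: lsum (delta R) k.+1 (pr x i) +
    (beta (len x - k.+1))%:C *: lsum (delta R) k (pr x i) +
    (lambda (len x - k.+1))%:C *: lsum_up k (pr x i))) => [|i _]; last first.
  by rewrite IHk -?(len_pr i x1) // -ltnS len_pr.
rewrite !big_split -!scaler_sumr; congr (_ + _ + _ *: _).
(* At depth 1 the upward terms of the d predecessors all fall on [x]; this is where the factor d
   arises. *)
case: k {IHk kx} => [|k] /=; last by rewrite -scaler_sumr.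
under eq_bigr do rewrite succ_pr //.
by rewrite sumr_const card_ord scaler_nat.
Qed.

End tree_sums.

(** * Zero-sum frames and tridiagonal matrices *)

(** An orthonormal basis of the zero-sum hyperplane: the rows after the first of an orthogonal
    matrix whose first row is constant. Orthogonality to that row gives sum 0, and dropping it from
    the column relations leaves the term 1/d. *)
Lemma zero_sum_frame (R : rcfType) (d : nat) : (2 <= d)%N ->
  exists U : 'I_d.-1 -> 'I_d -> R,
  [/\ forall h, \sum_i U h i = 0,
      forall h h', \sum_i U h i * U h' i = (h == h')%:R &
      forall i j, \sum_h U h i * U h j = (i == j)%:R - d%:R^-1].
Proof.
case: d => // n n1; set d := n.+1.
have d0 : 0 < d%:R :> R by rewrite ltr0n.
pose w : R := (Num.sqrt d%:R)^-1.
have w2 : w * w = d%:R^-1 by rewrite -invfM -expr2 sqr_sqrtr // ltW.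
have w1 : 1 - w != 0.
  apply/eqP => /eqP; rewrite subr_eq0 eq_sym => /eqP we; move: w2; rewrite we mulr1.
  by move=> /esym/eqP; rewrite invr_eq1 pnatr_eq1; case: n n1 @d d0 w we.
pose v : 'rV[R]_d := \row_j ((j == ord0)%:R - w).
(* The Householder reflection that maps the first basis vector to the constant unit vector. *)
pose Q : 'M[R]_d := 1%:M - (1 - w)^-1 *: (v^T *m v).
(* The squared length of [v] is 2(1 - w), so the coefficient in [Q] is 2 / |v|^2, as a reflection
   requires. It is defined because [w = 1] would mean d = 1. *)
have vv : v *m v^T = (2 - 2 * w)%:M.
  apply/rowP => j; rewrite !ord1 !mxE eqxx mulr1n big_ord_recl !mxE eqxx.
  under eq_bigr do rewrite !mxE /= sub0r mulrNN w2.
  rewrite sumr_const card_ord.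
  have -> : d%:R^-1 *+ n = 1 - w * w :> R.
    by rewrite w2 -mulr_natr /d -natr1; field; rewrite natr1 lt0r_neq0.
  by rewrite ?mulr1n; ring.
have QQ : Q *m Q = 1%:M.
  rewrite /Q mulmxBl mul1mx mulmxBr mulmx1 -scalemxAl -scalemxAr.
  rewrite mulmxA -(mulmxA _ v) vv mul_mx_scalar -scalemxAl !scalerA.
  rewrite (_ : (1 - w)^-1 * ((1 - w)^-1 * (2 - 2 * w)) = 2 * (1 - w)^-1).
    rewrite mulr_natl mulr2n scalerDl; set X := _ *: (_ *m _).
    by rewrite [X in _ - X](_ : _ = - X) ?opprK ?subrK // opprD addrA subrr sub0r.
  by field.
have Qsym i j : Q i j = Q j i.
  by rewrite !mxE eq_sym !big_ord1 !mxE [X in _ * X]mulrC.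
have Q0 j : Q ord0 j = w.
  rewrite !mxE big_ord1 !mxE eqxx mulrA mulVf // mul1r eq_sym /=.
  by rewrite opprB addrCA subrr addr0.
have QE i j : \sum_k Q i k * Q j k = (i == j)%:R.
  have := congr1 (fun M : 'M_d => M i j) QQ; rewrite !mxE => <-.
  by apply: eq_bigr => k _; rewrite (Qsym j).
have w0 : w != 0 by rewrite invr_eq0 sqrtr_eq0 -ltNge.
exists (fun h i => Q (lift ord0 h) i); split=> [h|h h'|i j].
- apply: (mulIf w0); rewrite mul0r mulr_suml.
  transitivity ((lift ord0 h == ord0)%:R : R); last by [].
  rewrite -(QE (lift ord0 h) ord0).
  by apply: eq_bigr => k _; rewrite Q0.
- by rewrite QE (inj_eq lift_inj).
have := QE i j; rewrite big_ord_recl ![Q _ ord0]Qsym !Q0 w2 => <-.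
rewrite addrC addKr; apply: eq_bigr => h _; by rewrite ![Q (lift _ _) _]Qsym.
Qed.

(** * Finite Jacobi matrices: spectral decomposition and roots of the polynomials *)

Section tridiagonal.
Context {C : numClosedFieldType}.
Variables a b : nat -> C.

(** The infinite Jacobi matrix; the truncations of all sizes arise by restricting the indices to
    ['I_n]. *)
Definition tridiag (k l : nat) : C :=
  (if l == k then b k else 0) + (if l == k.+1 then a k else 0) +
  (if l.+1 == k then a l else 0).

Lemma tridiagC k l : tridiag k l = tridiag l k.
Proof.
rewrite /tridiag (eq_sym l k) -addrA [_ + (if l.+1 == k then _ else _)]addrC addrA.
by rewrite (eq_sym l.+1 k) (eq_sym l k.+1); case: eqP => [->|].
Qed.

(** The upper term is lost exactly in the last row [k = n - 1]. Values in a module cover both scalar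
    sequences, through [C^o], and the vectors [usum]. *)
Lemma tridiag_sum (M : lmodType C) (u : nat -> M) n k : (k < n)%N ->
  \sum_(l < n) tridiag k l *: u l =
  prev_term a k *: prev_term u k + b k *: u k +
  (if (k.+1 < n)%N then a k *: u k.+1 else 0).
Proof.
move=> kn; have E j (F : nat -> C) :
    \sum_(l < n) (if l == j :> nat then F l else 0) *: u l =
    if (j < n)%N then F j *: u j else 0.
  rewrite -(big_ord1_eq +%R (fun l => F l *: u l) j n) [RHS]big_mkcond.
  by apply: eq_bigr => l _; case: ifP => //; rewrite scale0r.
rewrite /tridiag; under eq_bigr do rewrite !scalerDl.
rewrite !big_split /= (E k (fun=> b k)) (E k.+1 (fun=> a k)) kn.
rewrite addrC addrA; congr (_ + _ + _).
case: k kn => [|k] kn /=; first by rewrite scale0r big1 // => l _; rewrite scale0r.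
by rewrite (E k a) ltnW.
Qed.

(** The truncation A is real symmetric, hence normal, and has a unitary P with P A = diag(t) P. The
    eigenvectors are thus the rows of [P]; the first two clauses are their orthonormality and
    completeness. *)
Lemma tridiag_spectral n : (forall k, a k \is Num.real) -> (forall k, b k \is Num.real) ->
  exists (P : 'I_n -> 'I_n -> C) (t : 'I_n -> C),
  [/\ forall r r', \sum_k P r k * (P r' k)^* = (r == r')%:R,
      forall k l : 'I_n, \sum_(r < n) (P r k)^* * P r l = (k == l)%:R &
      forall r (l : 'I_n), \sum_(k < n) P r k * tridiag k l = t r * P r l].
Proof.
move=> ra rb; pose A : 'M[C]_n := \matrix_(k, l) tridiag k l.
have An : A \is normalmx.
  apply: symmetric_normalmx.
    apply/is_hermitianmxP; rewrite expr0 scale1r.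
    by apply/matrixP => k l; rewrite !mxE tridiagC.
  apply/mxOverP => k l; rewrite mxE /tridiag !realD //; case: ifP => // _; exact: real0.
have /orthomx_spectralP AE := An; set P := spectralmx A in AE.
have Pu : P \is unitarymx := spectral_unitarymx A.
exists P, (fun r => spectral_diag A ord0 r); split=> [r r'|k l|r l].
- have := congr1 (fun M : 'M_n => M r r') (unitarymxP Pu); rewrite !mxE => <-.
  by apply: eq_bigr => k _; rewrite !mxE.
- have := congr1 (fun M : 'M_n => M k l) (mulmx1C (unitarymxP Pu)); rewrite !mxE => <-.
  by apply: eq_bigr => r _; rewrite !mxE.
have PA : P *m A = diag_mx (spectral_diag A) *m P.
  by rewrite {1}AE !mulmxA mulmxV ?mul1mx // unitarymx_unit.
have := congr1 (fun M : 'M_n => M r l) PA; rewrite mul_diag_mx !mxE => <-.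
by apply: eq_bigr => k _; rewrite !mxE.
Qed.

(* The eigenvectors of the n x n truncation are the vectors (q_0(t), ..., q_(n-1)(t))
   with q_n(t) = 0. *)
Lemma tridiag_eigenvalue n (P : 'I_n -> 'I_n -> C) (t : 'I_n -> C) (q : nat -> C) z :
  (forall k, a k != 0) -> q 0%N = 1 ->
  (forall k, z * q k = prev_term a k * prev_term q k + b k * q k + a k * q k.+1) ->
  (forall r r', \sum_k P r k * (P r' k)^* = (r == r')%:R) ->
  (forall k l : 'I_n, \sum_(r < n) (P r k)^* * P r l = (k == l)%:R) ->
  (forall r (l : 'I_n), \sum_(k < n) P r k * tridiag k l = t r * P r l) -> (0 < n)%N ->
  (q n = 0 <-> exists r, t r = z).
Proof.
move=> a0 q0 qrec PP PP' PA n0; split=> [qn|[r tr]].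
  apply: contrapT => nt.
  (* Since [q n = 0], the truncation maps (q_0, ..., q_(n-1)) to z times itself. Pairing with row
     [r] gives both [t r] and [z] as factors, so the pairing vanishes; completeness of the rows then
     contradicts [q 0 = 1]. *)
  have Pq r : \sum_(l < n) P r l * q l = 0.
    have tz : t r - z != 0 by rewrite subr_eq0; apply/eqP => tz; apply: nt; exists r.
    apply: (mulfI tz); rewrite mulr0 mulrBl; apply/eqP; rewrite subr_eq0; apply/eqP.
    rewrite !mulr_sumr; transitivity (\sum_(l < n) \sum_(k < n) P r k * tridiag k l * q l).
      by apply: eq_bigr => l _; rewrite mulrA -PA mulr_suml.
    rewrite exchange_big; apply: eq_bigr => k _ /=.
    under eq_bigr do rewrite -mulrA; rewrite -mulr_sumr mulrCA qrec; congr (_ * _).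
    have /= -> := @tridiag_sum C^o q n k (ltn_ord k); congr (_ + _).
    have := ltn_ord k; rewrite leq_eqVlt => /orP[/eqP E|->//].
    by rewrite [X in (X < n)%N]E ltnn [q _.+1](_ : _ = 0) ?mulr0 // E.
  have : q 0%N = 0.
    have := PP' (Ordinal n0); pose i0 := Ordinal n0 => PP0.
    transitivity (\sum_(l < n) (i0 == l)%:R * q l).
      rewrite (bigD1 i0) // eqxx mul1r big1 => [|l li]; first by rewrite [RHS]addr0.
      by rewrite eq_sym (negbTE li) mul0r.
    under eq_bigr do rewrite -PP0 mulr_suml.
    rewrite exchange_big big1 // => r _; under eq_bigr do rewrite -mulrA.
    by rewrite -mulr_sumr Pq mulr0.
  by move/eqP; rewrite q0 oner_eq0.
(* The row is continued by 0, so that it satisfies the full recurrence below [n] with [u n = 0]. *)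
pose u k := if insub k is Some i then P r i else 0.
have uE (k : 'I_n) : u k = P r k by rewrite /u valK.
have un : u n = 0 by rewrite /u insubF // ltnn.
have urec k : (k < n)%N -> z * u k = prev_term a k * prev_term u k + b k * u k + a k * u k.+1.
  move=> kn; have := PA r (Ordinal kn); rewrite tr -uE => <-.
  transitivity (\sum_(l < n) tridiag k l * u l).
    by apply: eq_bigr => l _; rewrite uE mulrC tridiagC.
  have /= -> := @tridiag_sum C^o u n k kn; congr (_ + _).
  case: ltnP => // nk; have -> : k.+1 = n by apply/eqP; rewrite eqn_leq nk kn.
  by rewrite un mulr0.
(* The recurrence involves two earlier terms, so the induction carries two consecutive values. *)
have uq k : (k <= n)%N -> u k = u 0%N * q k /\ ((0 < k)%N -> u k.-1 = u 0%N * q k.-1).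
  elim: k => [|k IHk] kn; first by rewrite q0 mulr1.
  have [uk ukp] := IHk (ltnW kn); split=> //.
  apply: (mulfI (a0 k)); apply: (addrI (prev_term a k * prev_term u k + b k * u k)).
  rewrite -urec // uk mulrCA qrec mulrDr (mulrCA (u 0%N) (a k)); congr (_ + _).
  rewrite mulrDr (mulrCA _ (b k)); congr (_ + _); rewrite mulrCA; congr (_ * _).
  by case: k ukp {IHk kn uk} => [|k] /= ukp; rewrite ?mulr0 // -ukp.
have [unq _] := uq n (leqnn n).
have u00 : u 0%N != 0.
  apply/eqP => u00; have := PP r r; rewrite eqxx big1 => [/esym/eqP|k _].
    by rewrite oner_eq0.
  by rewrite -uE (proj1 (uq _ (ltnW (ltn_ord k)))) u00 !mul0r.
by apply: (mulfI u00); rewrite mulr0 -unq un.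
Qed.

End tridiagonal.


(** * Eigenvectors of the Jacobi operator *)

Section eigenvectors.
Context {R : realType} {d : nat} {L : tree d}.
Variables lambda beta : nat -> R.
Hypothesis d_ge2 : (2 <= d)%N.

Let sd : R := Num.sqrt d%:R.
Definition offdiag k : R[i] := (sd * lambda k)%:C.
Definition diag k : R[i] := (beta k)%:C.

Lemma offdiagE k : offdiag k = sd%:C * (lambda k)%:C.
Proof. exact: rmorphM. Qed.

Variables (U : 'I_d.-1 -> 'I_d -> R) (P : forall n, 'I_n -> 'I_n -> R[i])
  (t : forall n, 'I_n -> R[i]).
Hypothesis U_sum : forall h, \sum_i U h i = 0.
Hypothesis U_rows : forall h h', \sum_i U h i * U h' i = (h == h')%:R.
Hypothesis U_cols : forall i j, \sum_h U h i * U h j = (i == j)%:R - d%:R^-1.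
Hypothesis P_rows : forall n (r r' : 'I_n), \sum_k P r k * (P r' k)^* = (r == r')%:R.
Hypothesis P_cols : forall n (k l : 'I_n), \sum_r (P r k)^* * P r l = (k == l)%:R.
Hypothesis P_eigen : forall n (r l : 'I_n),
  \sum_(k < n) P r k * tridiag offdiag diag k l = t r * P r l.

Lemma sd_gt0 : 0 < sd.
Proof. by rewrite sqrtr_gt0 ltr0n; exact: ltn_trans d_ge2. Qed.

Lemma sd_neq0 : sd != 0. Proof. exact: lt0r_neq0 sd_gt0. Qed.

Lemma sd_sqr : sd * sd = d%:R.
Proof. by rewrite -expr2 sqr_sqrtr. Qed.

Lemma sdC_neq0 : sd%:C != 0 :> R[i].
Proof. by rewrite fmorph_eq0 sd_neq0. Qed.

Lemma sdC_sqr : sd%:C * sd%:C = d%:R :> R[i].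
Proof. by rewrite -rmorphM sd_sqr rmorph_nat. Qed.

(* The sum over the level k below x, scaled so that it is a unit vector for D = delta. *)
Definition usum (M : lmodType R[i]) (D : L -> M) x k : M :=
  (sd%:C^-1) ^+ (len x - k) *: lsum D (len x - k) x.

(** Tensor product of row [h] of the zero-sum frame, over the branches below [z], with row [r] of
    the eigenvector matrix of size [len z], over the levels 0, ..., [len z - 1]. *)
Definition evec (M : lmodType R[i]) (D : L -> M) z h (r : 'I_(len z)) : M :=
  \sum_i (U h i)%:C *: \sum_(k < len z) P r k *: usum D (pr z i) k.

(** One step between levels changes the scale by sqrt d, which turns d * lambda upward and lambda
    downward into the same sqrt d * lambda. At [k = len x] the upward term leaves the subtree. *)
Lemma usum_jacobi x k : (k <= len x)%N ->
  usum (jacobi_delta lambda beta) x k =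
    prev_term offdiag k *: prev_term (usum (delta R) x) k + diag k *: usum (delta R) x k +
    (if (k < len x)%N then offdiag k *: usum (delta R) x k.+1
     else (lambda k)%:C *: delta R (succ x)).
Proof.
move=> kx; rewrite {1}/usum lsum_jacobi ?leq_subr // subKn // !scalerDr.
congr (_ + _ + _).
- case: k kx => [|k] kx /=; first by rewrite rmorph0 !scale0r scaler0.
  rewrite /usum -(subnSK kx) !scalerA; congr (_ *: _).
  rewrite offdiagE [in RHS]exprS; have := sdC_neq0.
  move: (sd%:C) (_ ^+ _) ((lambda k)%:C : R[i]) => c e l c0; field.
  by rewrite c0.
- by rewrite /usum !scalerA mulrC.
case: ltnP => kx'; last first.
  have -> : (len x - k = 0)%N by apply/eqP; rewrite subn_eq0.
  by rewrite expr0 scale1r.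
rewrite /usum -(subnSK kx') /= !scalerA; congr (_ *: _).
rewrite offdiagE -sdC_sqr exprS; have := sdC_neq0.
move: (sd%:C) (_ ^+ _) ((lambda k)%:C : R[i]) => c e l c0; field.
by rewrite c0.
Qed.

Lemma len_pr1 z i : (0 < len z)%N -> len (pr z i : L) = (len z).-1.
Proof. by move=> z0; rewrite -(len_pr i z0). Qed.

Lemma evec_jacobi z h (r : 'I_(len z)) :
  evec (jacobi_delta lambda beta) h r = t r *: evec (delta R) h r.
Proof.
have z0 : (0 < len z)%N by case: (len z) r => [[]|].
(* The coefficient of the leak into [z]. Only the top level [k = len z - 1] contributes, and it does
   not depend on the branch [i], so [U_sum] removes it. *)
pose c := \sum_(k < len z) P r k * (if (k.+1 < len z)%N then 0 else (lambda k)%:C).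
transitivity (\sum_i (U h i)%:C *:
   (t r *: (\sum_(k < len z) P r k *: usum (delta R) (pr z i) k) + c *: delta R z)).
  apply: eq_bigr => i _; congr (_ *: _); rewrite /c scaler_suml [t r *: _]scaler_sumr.
  rewrite [X in _ = X + _](eq_bigr (fun l : 'I_(len z) =>
      \sum_(k < len z) (P r k * tridiag offdiag diag k l) *:
      usum (delta R) (pr z i) l)); last first.
    by move=> l _; rewrite scalerA -P_eigen scaler_suml.
  rewrite [X in _ = X + _]exchange_big -big_split; apply: eq_bigr => k _ /=.
  under eq_bigr do rewrite -scalerA; rewrite -scaler_sumr -scalerA -scalerDr; congr (_ *: _).
  rewrite usum_jacobi ?(len_pr1 _ z0) ?(tridiag_sum _ _ _ (ltn_ord k)); last first.
    by rewrite -ltnS prednK.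
  rewrite -[RHS]addrA; congr (_ + _).
  have -> : (k < (len z).-1)%N = (k.+1 < len z)%N by rewrite ltn_predRL.
  by case: ifP => _; rewrite ?scale0r ?addr0 // add0r succ_pr.
under eq_bigr do rewrite scalerDr; rewrite big_split /= -scaler_suml -rmorph_sum U_sum.
rewrite rmorph0 scale0r addr0 /evec scaler_sumr.
by apply: eq_bigr => i _; rewrite !scalerA mulrC.
Qed.

(** On a common level, if [x] is below [x'], the d^j shared vertices with j = [len x - k] carry the
    weights sqrt d^(-j) and sqrt d^(-m-j), which leaves sqrt d^(-m). *)
Lemma dot_usum m k k' x x' : (k <= len x)%N -> (k' <= len x')%N ->
  len x' = (m + len x)%N ->
  l2dot (usum (delta R) x' k') (usum (delta R) x k) =
  (k == k')%:R * (iter m succ x == x')%:R * (sd%:C^-1) ^+ m.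
Proof.
move=> kx kx' lx; rewrite /usum l2dotZl l2dotZr.
have -> j : Num.conj (sd%:C^-1 ^+ j) = sd%:C^-1 ^+ j.
  by rewrite rmorphXn fmorphV; congr (_^-1 ^+ _); exact: conjc_real.
have [kk|kk] := eqVneq k k'; last first.
  rewrite dot_lsum0 ?leq_subr // ?mul0r ?mulr0 ?mul0r // => E; move/eqP: kk; apply.
  by rewrite lx in E kx'; lia.
rewrite -kk lx -addnBA // dot_lsum ?leq_subr // mul1r -sdC_sqr.
rewrite !exprVn exprD exprMn; have := expf_neq0 (len x - k) sdC_neq0.
have := expf_neq0 m sdC_neq0.
move: (sd%:C ^+ _) (sd%:C ^+ _) (_ == _)%:R => u v w v0 u0; field.
by rewrite u0 v0.
Qed.

Lemma dot_evecr V z h (r : 'I_(len z)) :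
  l2dot V (evec (delta R) h r) = \sum_i (U h i)%:C *
    \sum_(k < len z) (P r k)^* * l2dot V (usum (delta R) (pr z i) k).
Proof.
rewrite l2dot_sumr; apply: eq_bigr => i _; rewrite l2dotZr.
rewrite [X in X * _](_ : _ = (U h i)%:C); last exact: conjc_real.
by rewrite l2dot_sumr; congr (_ * _); apply: eq_bigr => k _; rewrite l2dotZr.
Qed.

Lemma dot_evecl V z h (r : 'I_(len z)) :
  l2dot (evec (delta R) h r) V = \sum_i (U h i)%:C *
    \sum_(k < len z) P r k * l2dot (usum (delta R) (pr z i) k) V.
Proof.
rewrite l2dot_suml; apply: eq_bigr => i _; rewrite l2dotZl.
by rewrite l2dot_suml; congr (_ * _); apply: eq_bigr => k _; rewrite l2dotZl.
Qed.

Lemma sum_UC h : \sum_i (U h i)%:C = 0 :> R[i].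
Proof. by rewrite -rmorph_sum U_sum. Qed.

(** For the lower vertex [z], the branches below [z] lie either all inside one given branch of [z']
    or all outside it. The inner products are thus independent of [i], and the zero sum of [U h]
    annihilates them. *)
Lemma dot_evec_level m z z' h h' (r : 'I_(len z)) (r' : 'I_(len z')) :
  len z' = (m + len z)%N -> z <> z' ->
  l2dot (evec (delta R) h' r') (evec (delta R) h r) = 0.
Proof.
have z0 : (0 < len z)%N by case: (len z) r => [[]|].
have z0' : (0 < len z')%N by case: (len z') r' => [[]|].
move=> lz zz'; have lpr i i' : len (pr z' i') = (m + len (pr z i))%N.
  by apply/eqP; rewrite -eqSS len_pr // -addnS len_pr // lz.
have E i i' (k : 'I_(len z)) (k' : 'I_(len z')) :
    l2dot (usum (delta R) (pr z' i') k') (usum (delta R) (pr z i) k) =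
    (k == k' :> nat)%:R * ((0 < m)%N && (iter m.-1 succ z == pr z' i'))%:R * (sd%:C^-1) ^+ m.
  rewrite (dot_usum (m := m)); last 3 first.
  - by rewrite len_pr1 // -ltnS prednK.
  - by rewrite len_pr1 // -ltnS prednK.
  - exact: lpr.
  congr (_ * _%:R * _); case: m {lz lpr} => [|m] /=; last by rewrite -iterS iterSr succ_pr.
  by case: eqP => // E; case: zz'; rewrite -(succ_pr i z0) E succ_pr.
rewrite dot_evecl; apply: big1 => i' _; rewrite big1 ?mulr0 // => k' _.
rewrite dot_evecr.
have cst i : \sum_(k < len z) (P r k)^* *
     l2dot (usum (delta R) (pr z' i') k') (usum (delta R) (pr z i) k) =
   \sum_(k < len z) (P r k)^* * ((k == k' :> nat)%:R *
     ((0 < m)%N && (iter m.-1 succ z == pr z' i'))%:R * (sd%:C^-1) ^+ m).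
  by apply: eq_bigr => k _; rewrite E.
under eq_bigr do rewrite cst.
by rewrite -mulr_suml sum_UC mul0r mulr0.
Qed.

Lemma dot_evec z h h' (r r' : 'I_(len z)) :
  l2dot (evec (delta R) h r) (evec (delta R) h' r') = ((h == h') && (r == r'))%:R.
Proof.
have z0 : (0 < len z)%N by case: (len z) r => [[]|].
have E i i' (k k' : 'I_(len z)) :
    l2dot (usum (delta R) (pr z i) k) (usum (delta R) (pr z i') k') =
    (k == k')%:R * (i == i')%:R.
  rewrite (dot_usum (m := 0)) ?len_pr1 //; last 2 first.
  - by rewrite -ltnS prednK.
  - by rewrite -ltnS prednK.
  by rewrite /= expr0 mulr1 (inj_eq (pr_inj z0)) (eq_sym i) (eq_sym k).
rewrite dot_evecl; transitivity (\sum_i (U h i)%:C * (U h' i)%:C * (r == r')%:R : R[i]).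
  apply: eq_bigr => i _; rewrite -mulrA; congr (_ * _).
  transitivity (\sum_(k < len z) P r k * ((U h' i)%:C * (P r' k)^*)).
    apply: eq_bigr => k _; congr (_ * _); rewrite dot_evecr (bigD1 i) //= [X in _ + X]big1.
      rewrite addr0; congr (_ * _); rewrite (bigD1 k) //= [X in _ + X]big1.
        by rewrite addr0 E !eqxx !mulr1.
      by move=> k' kk'; rewrite E eq_sym (negbTE kk') mul0r mulr0.
    move=> j ji; rewrite big1 ?mulr0 // => k' _.
    by rewrite E eq_sym [i == j]eq_sym (negbTE ji) !mulr0.
  rewrite -P_rows mulr_sumr; apply: eq_bigr => k _; exact: mulrCA.
rewrite -mulr_suml; under eq_bigr do rewrite -rmorphM.
by rewrite -rmorph_sum U_rows rmorph_nat -natrM mulnb.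
Qed.

(** Inverts the construction of [evec]: the columns of [P] recover a single level, and those of [U]
    recover branch [i] up to its projection on the constants, which is the subtracted mean. *)
Lemma usum_sub_average (M : lmodType R[i]) (D : L -> M) z i (k : 'I_(len z)) :
  usum D (pr z i) k - d%:R^-1 *: \sum_j usum D (pr z j) k =
  \sum_h \sum_(r < len z) ((U h i)%:C * (P r k)^*) *: evec D h r.
Proof.
have Ecol (l : 'I_(len z)) v :
    \sum_(r < len z) ((P r k)^* * P r l) *: v = (k == l)%:R *: v :> M.
  by rewrite -scaler_suml P_cols.
transitivity (\sum_h \sum_j ((U h i)%:C * (U h j)%:C) *: usum D (pr z j) k).
  rewrite exchange_big /=.
  transitivity (\sum_j ((i == j)%:R - d%:R^-1) *: usum D (pr z j) k).
    under [RHS]eq_bigr do rewrite scalerBl; rewrite sumrB -scaler_sumr; congr (_ - _).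
    rewrite [RHS](bigD1 i) //= eqxx scale1r big1 ?addr0 // => j ji.
    by rewrite eq_sym (negbTE ji) scale0r.
  apply: eq_bigr => j _; rewrite -scaler_suml; congr (_ *: _).
  under eq_bigr do rewrite -rmorphM.
  by rewrite -rmorph_sum U_cols rmorphB rmorph_nat fmorphV rmorph_nat.
apply: eq_bigr => h _; rewrite /evec.
transitivity (\sum_j \sum_(l < len z) \sum_(r < len z)
    ((U h i)%:C * (U h j)%:C) *: (((P r k)^* * P r l) *: usum D (pr z j) l)).
  apply: eq_bigr => j _; rewrite (bigD1 k) //= -scaler_sumr Ecol eqxx scale1r.
  rewrite big1 ?addr0 // => l lk; rewrite -scaler_sumr Ecol eq_sym (negbTE lk).
  by rewrite scale0r scaler0.
under eq_bigr do rewrite exchange_big /=; rewrite exchange_big; apply: eq_bigr => r _ /=.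
rewrite scaler_sumr; apply: eq_bigr => j _; rewrite !scaler_sumr; apply: eq_bigr => l _.
by rewrite !scalerA; congr (_ *: _); ring.
Qed.

End eigenvectors.

(** * Totality of the eigenvectors in the graph norm *)

Section eigenvector_closure.
Context {R : realType} {d : nat} {L : tree d}.
Hypothesis d_ge2 : (2 <= d)%N.
Variables (U : 'I_d.-1 -> 'I_d -> R) (P : forall n, 'I_n -> 'I_n -> R[i]).
Hypothesis U_cols : forall i j, \sum_h U h i * U h j = (i == j)%:R - d%:R^-1.
Hypothesis P_cols : forall n (k l : 'I_n), \sum_r (P r k)^* * P r l = (k == l)%:R.

Definition eindex := {z : L & ('I_d.-1 * 'I_(len z))%type}.

Definition eigenfun (M : lmodType R[i]) (D : L -> M) (i : eindex) : M :=
  evec U P D (tagged i).1 (tagged i).2.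

Definition average (M : lmodType R[i]) (D : L -> M) k y : M :=
  d%:R^-1 ^+ k *: lsum D k (iter k succ y).

Let sd : R := Num.sqrt d%:R.

(** The average below z = succ^(k+1) y is the mean of the averages below its d predecessors, and
    [average D k y] belongs to the branch [i] containing [y]; up to scale this is [usum_sub_average]
    on level [len y]. *)
Lemma average_step (M : normedModType R[i]) (D : L -> M) k y :
  lin (range (eigenfun D)) (average D k y - average D k.+1 y).
Proof.
have [i yi] := pr_surj (iter k succ y).
set z := iter k.+1 succ y; rewrite -/z in yi.
have lz : len z = (k + len y).+1 by rewrite /z len_iter_succ.
have z0 : (0 < len z)%N by rewrite lz.
have lzy : (len y < len z)%N by rewrite lz ltnS leq_addl.
have sdk : sd%:C ^+ k != 0 :> R[i] by rewrite expf_neq0 // sdC_neq0.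
have lE j : lsum D k (pr z j) = sd%:C ^+ k *: usum D (pr z j) (Ordinal lzy).
  rewrite /usum /= len_pr1 // lz /= addnK scalerA exprVn mulfV ?scale1r //.
have -> : average D k y - average D k.+1 y = (d%:R^-1 ^+ k * sd%:C ^+ k) *:
    (usum D (pr z i) (Ordinal lzy) - d%:R^-1 *: \sum_j usum D (pr z j) (Ordinal lzy)).
  rewrite /average -/z -yi /= lE; under eq_bigr do rewrite lE.
  rewrite -scaler_sumr exprS scalerBr !scalerA; congr (_ - _ *: _).
  by rewrite -mulrA mulrC -!mulrA.
apply: subspaceZ; first exact: lin_subspace.
rewrite (usum_sub_average U_cols P_cols).
apply: (subspace_sum (S := lin _)) => [|h _]; first exact: lin_subspace.
apply: (subspace_sum (S := lin _)) => [|r _]; first exact: lin_subspace.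
apply: subspaceZ; first exact: lin_subspace.
by apply: sub_lin; exists (existT _ z (h, r)).
Qed.

Lemma sub_average (M : normedModType R[i]) (D : L -> M) k y :
  lin (range (eigenfun D)) (D y - average D k y).
Proof.
elim: k => [|k IHk].
  by rewrite /average expr0 scale1r subrr; exact: (proj1 (lin_subspace _)).
rewrite -[D y](subrK (average D k y)) -addrA.
by apply: subspaceD IHk (average_step D k y); exact: lin_subspace.
Qed.

Lemma norm_lsum k (x : L) : (k <= len x)%N -> `|lsum (delta R) k x| = (sd ^+ k)%:C.
Proof.
move=> kx; apply/eqP; rewrite -(eqrXn2 (n := 2)) //; last first.
  by rewrite ler0c exprn_ge0 // sqrtr_ge0.
rewrite l2norm_sqr (dot_lsum (m := 0)) //= eqxx mulr1 -sdC_sqr exprMn.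
by rewrite expr2 rmorphXn.
Qed.

(** [K] depends on the level [l] of the summands but not on [k], so division by d^k sends the images
    under J to 0 as well. *)
Lemma norm_lsum_jacobi (lambda beta : nat -> R) l : exists K : R, 0 <= K /\
  forall k (x : L), len x = (k + l)%N ->
    `|lsum (jacobi_delta lambda beta) k x| <= (K * sd ^+ k)%:C.
Proof.
have s1 : 1 <= sd by rewrite -sqrtr1 ler_wsqrtr // ler1n (ltn_trans _ d_ge2).
have s0 : 0 <= sd := sqrtr_ge0 _.
(* The sums on the two neighbouring levels have norm at most [sd * sd ^+ k]; at [k = 0] the upper
   one is a single delta and [1 <= sd] is used. *)
exists (`|prev_term lambda l| * sd + `|beta l| + `|lambda l| * sd); split.
  by rewrite !addr_ge0 ?mulr_ge0.
move=> k x lx; rewrite lsum_jacobi ?lx ?leq_addr // addKn.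
have up : `|lsum_up (R := R) k x| <= (sd * sd ^+ k)%:C.
  case: k lx => [|k] lx /=.
    by rewrite -[delta R _]/(lsum (delta R) 0 (succ x)) norm_lsum // lecR expr0 mulr1.
  rewrite normrZ norm_lsum ?lx ?(leq_trans _ (leq_addr _ _)) // normr_nat.
  by rewrite -sdC_sqr -/sd -!rmorphM lecR exprS mulrA.
have nC (c : R) : `|c%:C| = `|c|%:C :> R[i].
  by rewrite normc_def /= expr0n addr0 sqrtr_sqr.
apply: le_trans (ler_normD _ _) _; rewrite !mulrDl !rmorphD /=; apply: lerD; last first.
  by rewrite normrZ nC -mulrA rmorphM ler_wpM2l // ler0c.
apply: le_trans (ler_normD _ _) _; apply: lerD.
  rewrite normrZ nC -mulrA rmorphM /=; case: l lx => [|l] lx.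
    by rewrite normr0 !mul0r.
  have := @norm_lsum k.+1 x; rewrite lx addnS ltnS leq_addr => /(_ isT) /= ->.
  by rewrite ler_wpM2l ?ler0c // exprS.
by rewrite normrZ nC rmorphM norm_lsum // lx leq_addr.
Qed.

Lemma delta_graph_closure (lambda beta : nat -> R) y :
  let D := fun x : L => (delta R x, jacobi_delta lambda beta x) in
  closure (lin (range (eigenfun D))) (D y).
Proof.
move=> D; apply/closure_normP => e e0.
have re0 : 0 < complex.Re e by move: e0; rewrite ltcE => /andP[].
have eE : e = (complex.Re e)%:C.
  by move: e0; case: (e) => a b; rewrite ltcE => /andP[/eqP /= -> _].
have [K [K0 HK]] := norm_lsum_jacobi lambda beta (len y).
have sd0 : 0 < sd by exact: sd_gt0.
have si : `|sd^-1| < 1.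
  rewrite ger0_norm ?invr_ge0 ?ltW // invf_lt1 // -sqrtr1 ltr_sqrt ?ltr1n //.
  by rewrite ltr0n (ltn_trans _ d_ge2).
(* The norm on pairs is a maximum; [1 + K] dominates the constant 1 of the vector and the constant
   [K] of its image. *)
have [k kE] : exists k, (1 + K) * sd^-1 ^+ k < complex.Re e.
  have K1 : 0 < 1 + K by rewrite ltr_wpDr.
  have /cvgrPdist_lt/(_ (complex.Re e / (1 + K)))[] := cvg_expr si.
    by rewrite divr_gt0.
  move=> k _ /(_ k (leqnn k)); rewrite /= sub0r normrN => kE; exists k.
  by rewrite mulrC -ltr_pdivlMr //; apply: le_lt_trans kE; exact: ler_norm.
exists (D y - average D k y); first exact: sub_average.
rewrite subKr; apply: (@le_lt_trans _ _ ((1 + K) * sd^-1 ^+ k)%:C); last first.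
  by rewrite eE ltcR.
have fstE : (lsum D k (iter k succ y)).1 = lsum (delta R) k (iter k succ y).
  exact: (lsum_morph (phi := fst)).
have sndE : (lsum D k (iter k succ y)).2 = lsum (jacobi_delta lambda beta) k (iter k succ y).
  exact: (lsum_morph (phi := snd)).
have lE : len (iter k succ y) = (k + len y)%N by rewrite len_iter_succ.
have scaleE (c : R) : (d%:R^-1 ^+ k : R[i]) * (c * sd ^+ k)%:C = (c * sd^-1 ^+ k)%:C.
  have -> : d%:R^-1 ^+ k = (d%:R^-1 ^+ k)%:C :> R[i].
    by rewrite rmorphXn fmorphV rmorph_nat.
  rewrite -rmorphM -sd_sqr -/sd; congr _%:C; have : sd ^+ k != 0.
    by rewrite expf_neq0 ?lt0r_neq0.
  by rewrite !exprVn exprMn; move: (sd ^+ k) => s sn0; field.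
have dk0 : `|d%:R^-1 ^+ k| = d%:R^-1 ^+ k :> R[i].
  by rewrite ger0_norm // exprn_ge0 // invr_ge0 ler0n.
have dk1 : 0 <= d%:R^-1 ^+ k :> R[i] by rewrite exprn_ge0 // invr_ge0 ler0n.
rewrite prod_normE num_ge_max /average /= fstE sndE !normrZ dk0; apply/andP; split.
  rewrite norm_lsum ?lE ?leq_addr // -[sd ^+ k]mul1r scaleE lecR.
  by rewrite ler_pM2r ?exprn_gt0 ?invr_gt0 // lerDl.
apply: le_trans (ler_wpM2l dk1 (HK k _ lE)) _; rewrite scaleE lecR.
by rewrite ler_pM2r ?exprn_gt0 ?invr_gt0 // lerDr.
Qed.

End eigenvector_closure.

(** * Spectrum of an operator with an orthonormal eigenbasis *)

Section eigenbasis_spectrum.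
Context {R : realType} {V : choiceType} {I : eqType}.
Variables (e : I -> l2 R V) (tau : I -> R[i]).
Hypothesis e_orth : forall a b, l2dot (e a) (e b) = (a == b)%:R.
Hypothesis e_dense : closure (lin (range e)) = [set: l2 R V].

Let G a : l2 R V * l2 R V := (e a, tau a *: e a).
Let T : set (l2 R V * l2 R V) := closure (lin (range G)).

Lemma closure_graph_subspace : subspace T.
Proof. exact/closure_subspace/lin_subspace. Qed.

Lemma norm_eigenbasis a : `|e a| = 1.
Proof.
apply/eqP; rewrite -(eqrXn2 (n := 2)) //.
by rewrite l2norm_sqr e_orth eqxx expr1n.
Qed.

Lemma pythagoras (s : seq I) (c : I -> R[i]) : uniq s ->
  `|\sum_(a <- s) c a *: e a| ^+ 2 = \sum_(a <- s) `|c a| ^+ 2.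
Proof.
move=> us; rewrite l2norm_sqr l2dot_suml big_seq [RHS]big_seq; apply: eq_bigr => a as_.
rewrite l2dotZl l2dot_sumr (bigD1_seq a) //= l2dotZr e_orth eqxx mulr1 big1.
  by rewrite addr0 -sqr_normc.
by move=> b ba; rewrite l2dotZr e_orth eq_sym (negbTE ba) mulr0.
Qed.

(** On the span this is Pythagoras, coefficient by coefficient; the inequality is stable under
    limits in the graph. *)
Lemma resolvent_bound z (r : R) f g : 0 <= r -> (forall a, r%:C <= `|tau a - z|) ->
  T (f, g) -> r%:C * `|f| <= `|g - z *: f|.
Proof.
move=> r0 rtau.
have key f' g' : lin (range G) (f', g') -> r%:C * `|f'| <= `|g' - z *: f'|.
  move=> /lin_range_uniq[s [c [us fgE]]].
  have fE : f' = \sum_(a <- s) c a *: e a.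
    have := congr1 fst fgE; rewrite /= => ->.
    exact: (big_morph fst (fun x y => erefl) erefl).
  have gE : g' - z *: f' = \sum_(a <- s) (c a * (tau a - z)) *: e a.
    have := congr1 snd fgE; rewrite /= => ->.
    rewrite (big_morph snd (fun x y => erefl) erefl) fE scaler_sumr -sumrB.
    by apply: eq_bigr => a _ /=; rewrite !scalerA -scalerBl mulrBr [z * _]mulrC.
  rewrite -(ler_pXn2r (n := 2)) ?nnegrE ?mulr_ge0 ?ler0c //.
  rewrite exprMn gE fE !pythagoras // mulr_sumr; apply: ler_sum => a _.
  rewrite normrM exprMn mulrC ler_wpM2l ?exprn_ge0 //.
  by apply: lerXn2r (rtau a); rewrite nnegrE ?ler0c ?normc_ge0.
move=> /closure_normP Tfg; apply/ler_addgt0Pr => eta eta0.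
(* The errors from [g], from [z *: f] and from [r * |f|] have weights 1, |z| and r and must add up
   to [eta]. *)
pose M := 1 + `|z| + r%:C.
have M0 : 0 < M by rewrite ltr_wpDr ?ler0c // ltr_wpDr.
have [[f' g'] Gfg] := Tfg _ (divr_gt0 eta0 M0).
rewrite prod_normE num_gt_max /= => /andP[ff gg].
have E : g' - z *: f' = (g - z *: f) - ((g - g') - z *: (f - f')).
  by rewrite scalerBr opprB addrA addrA subrK opprB [RHS]addrC addrA subrK.
have fE : `|f| <= `|f'| + `|f - f'|.
  by rewrite -{1}(subrKC f' f) ler_normD.
have rf : r%:C * `|f| <= r%:C * `|f'| + r%:C * (eta / M).
  apply: (@le_trans _ _ (r%:C * (`|f'| + `|f - f'|))); first by rewrite ler_wpM2l ?ler0c.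
  by rewrite mulrDr lerD2l ler_wpM2l ?ler0c // ltW.
apply: le_trans rf _; apply: le_trans (lerD (key _ _ Gfg) (lexx _)) _.
have etaE : eta = eta / M + `|z| * (eta / M) + r%:C * (eta / M).
  by rewrite -{1}(divfK (lt0r_neq0 M0) eta) /M; ring.
rewrite [X in _ <= _ + X]etaE addrA lerD2r E.
apply: le_trans (ler_normB _ _) _; rewrite lerD2l.
apply: le_trans (ler_normB _ _) _; apply: lerD; first exact: ltW.
by rewrite normrZ ler_wpM2l // ltW.
Qed.

(** The range of T - z contains each [e a], hence is dense. Preimages of a sequence tending to [g]
    are Cauchy by [resolvent_bound], and the closed graph contains their limit. *)
Lemma resolvent_surj z (r : R) g : 0 < r -> (forall a, r%:C <= `|tau a - z|) ->
  exists f, T (f, g + z *: f).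
Proof.
move=> r0 rtau; have rC : 0 < r%:C :> R[i] by rewrite ltcR.
have lT := closure_graph_subspace.
pose S := [set h : l2 R V | exists f, T (f, h + z *: f)].
have lS : subspace S.
  split; first by exists 0; rewrite scaler0 addr0; exact: (proj1 lT).
  move=> c h h' [f Tf] [f' Tf']; exists (c *: f + f').
  have := proj2 lT c _ _ Tf Tf'; congr T; congr (_, _) => /=.
  by rewrite !scalerDr addrACA !scalerA [c * z]mulrC.
have Se : lin (range e) `<=` S.
  apply: lin_min => // _ [a _ <-].
  have tz : tau a - z != 0 by rewrite -normr_gt0; exact: lt_le_trans (rtau a).
  exists ((tau a - z)^-1 *: e a).
  have : T ((tau a - z)^-1 *: G a).
    by apply: (subspaceZ _ lT); apply: subset_closure; apply: sub_lin; exists a.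
  congr T; congr (_, _) => /=; rewrite !scalerA.
  transitivity ((1 + z * (tau a - z)^-1) *: e a); last by rewrite scalerDl scale1r.
  by congr (_ *: _); field.
have gT : closure (lin (range e)) g by rewrite e_dense.
have /choice[h hP] : forall n, exists y : l2 R V, S y /\ `|g - y| < (n.+1%:R^-1 : R)%:C.
  move=> n; move/closure_normP : gT => /(_ (n.+1%:R^-1 : R)%:C).
  by rewrite ltcR invr_gt0 ltr0n => /(_ isT)[h' /Se Sh' gh']; exists h'.
have /choice[f fP] : forall n, exists y, T (y, h n + z *: y).
  by move=> n; exact: (proj1 (hP n)).
(* Both [h n] and [h m] are within 1/(n+1) of [g], and [resolvent_bound] costs a factor 1/r. *)
pose eps n : R := r^-1 * (2 * n.+1%:R^-1).
have eps0 : eps @ \oo --> 0.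
  rewrite -[0](mulr0 (r^-1 * 2)).
  have -> : eps = fun n => (r^-1 * 2) * harmonic n by apply/funext => n; rewrite /eps mulrA.
  by apply: cvgM; [exact: cvg_cst|exact: cvg_harmonic].
have feps n m : (n <= m)%N -> `|f n - f m| <= (eps n)%:C.
  move=> nm; rewrite /eps rmorphM fmorphV ler_pdivlMl //.
  have := @resolvent_bound z r (f n - f m) (h n - h m + z *: (f n - f m)) (ltW r0) rtau.
  rewrite addrK => /(_ _)/le_trans; apply.
    have := subspaceB lT (fP n) (fP m); congr T; congr (_, _) => /=.
    by rewrite scalerBr opprD addrACA.
  have -> : h n - h m = (g - h m) - (g - h n) by rewrite opprB [RHS]addrC addrA subrK.
  apply: le_trans (ler_normB _ _) _; rewrite mulr_natl mulr2n rmorphD.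
  apply: lerD; last exact: ltW (proj2 (hP n)).
  apply: le_trans (ltW (proj2 (hP m))) _; rewrite lecR lef_pV2 ?posrE ?ltr0n //.
  by rewrite ler_nat ltnS.
have [f0 f0P] := l2_complete feps eps0.
exists f0; rewrite /T (proj1 (closure_id _) (@closed_closure _ _)) -/T.
apply/closure_normP => d d0.
have rd : 0 < complex.Re d by move: d0; rewrite ltcE => /andP[].
have dE : d = (complex.Re d)%:C.
  by move: d0; case: (d) => a b; rewrite ltcE => /andP[/eqP /= -> _].
pose M : R := 1 + normc z.
have M1 : 1 <= M by rewrite lerDl normc_ge0.
have M0 : 0 < M := lt_le_trans ltr01 M1.
have [n nE] : exists n, n.+1%:R^-1 + M * eps n < complex.Re d.
  have lim : (fun n => n.+1%:R^-1 + M * eps n) @ \oo --> (0 : R).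
    rewrite -[0]addr0; apply: cvgD; first exact: cvg_harmonic.
    by rewrite -[0](mulr0 M); apply: cvgM => //; exact: cvg_cst.
  have /cvgrPdist_lt/(_ _ rd)[n _ /(_ n (leqnn n))] := lim.
  by rewrite /= sub0r normrN => nE; exists n; apply: le_lt_trans nE; exact: ler_norm.
have eps_ge0 : 0 <= eps n by rewrite !mulr_ge0 ?invr_ge0 ?ltW // ler0n.
exists (f n, h n + z *: f n); first exact: fP.
have ff : `|f0 - f n| <= (eps n)%:C by rewrite distrC.
apply: (@le_lt_trans _ _ (n.+1%:R^-1 + M * eps n)%:C); last by rewrite dE ltcR.
rewrite prod_normE num_ge_max /=; apply/andP; split.
  apply: le_trans ff _; rewrite lecR; apply: ler_wpDl; first by rewrite invr_ge0.
  by rewrite ler_peMl.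
rewrite opprD addrACA -scalerBr; apply: le_trans (ler_normD _ _) _.
rewrite rmorphD; apply: lerD; first exact: ltW (proj2 (hP n)).
rewrite normrZ; apply: (@le_trans _ _ (normc z * eps n)%:C).
  by rewrite rmorphM normc_normE ler_wpM2l // ler0c normc_ge0.
by rewrite lecR ler_wpM2r // lerDr.
Qed.

Lemma spectrum_eigenbasis : spectrum T = closure (range tau : set R[i]^o).
Proof.
apply/seteqP; split=> z.
  apply: contra_notP => /closure_normP nz.
  have [r [r0 rtau]] : exists r : R, 0 < r /\ forall a, r%:C <= `|tau a - z|.
    apply: contrapT => nr; apply: nz => d d0.
    have rd : 0 < complex.Re d by move: d0; rewrite ltcE => /andP[].
    have dE : d = (complex.Re d)%:C.
      by move: d0; case: (d) => a b; rewrite ltcE => /andP[/eqP /= -> _].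
    apply: contrapT => nd; apply: nr; exists (complex.Re d); split=> // a.
    rewrite -dE real_leNgt ?realE ?(ltW d0) ?normr_ge0 //; apply/negP => tad.
    by apply: nd; exists (tau a); [exists a|rewrite distrC].
  have rC : 0 < r%:C :> R[i] by rewrite ltcR.
  have B f g : T (f, g + z *: f) -> r%:C * `|f| <= `|g|.
    by move=> /(resolvent_bound (ltW r0) rtau); rewrite addrK.
  split; last first.
    by exists (r%:C^-1) => f g /B; rewrite ler_pdivlMl.
  move=> g; have [f Tf] := resolvent_surj g r0 rtau; exists f; split=> // f' Tf'.
  have := subspaceB closure_graph_subspace Tf Tf'.
  rewrite (_ : _ - _ = (f - f', 0 + z *: (f - f'))); last first.
    by congr (_, _); rewrite /= scalerBr opprD addrACA subrr.
  move=> /B; rewrite normr0 pmulr_rle0 // normr_le0 subr_eq0 => /eqP; exact.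
move=> /closure_normP cz [_ [M HM]].
have M0 : 0 < `|M| + 1 by rewrite ltr_wpDl.
have M1_gt0 : 0 < (`|M| + 1)^-1 by rewrite invr_gt0.
have [_ [a _ <-] za] := cz _ M1_gt0.
have : T (e a, (tau a - z) *: e a + z *: e a).
  by rewrite scalerBl subrK; apply: subset_closure; apply: sub_lin; exists a.
move=> /HM; rewrite normrZ norm_eigenbasis mulr1 => M1.
(* The bound [M] is only a complex number; as the product is at least 1 it is positive, and [M] may
   be replaced by its modulus. *)
have Mx : M * `|tau a - z| = `|M| * `|tau a - z|.
  rewrite -[LHS]ger0_norm ?(le_trans ler01 M1) //.
  by rewrite normrM normr_id.
have : 1 < 1 :> R[i].
  apply: le_lt_trans M1 _; rewrite Mx.
  apply: (@le_lt_trans _ _ ((`|M| + 1) * `|tau a - z|)).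
    by rewrite ler_wpM2r // lerDl.
  by rewrite mulrC -ltr_pdivlMr // mul1r distrC.
by rewrite ltxx.
Qed.

End eigenbasis_spectrum.

(** * The graph of J as a linear span *)

Section jacobi_graph.
Context {R : realType} {d : nat} {L : tree d}.
Variables lambda beta : nat -> R.

Definition jacobi_pair (x : L) : l2 R L * l2 R L :=
  (delta R x, jacobi_delta lambda beta x).

Lemma delta_expansion (M : lmodType R[i]) (s : seq L) (c : L -> R[i]) (F : L -> M) :
  uniq s ->
  \sum_(x \in [set: L]) \val (\sum_(a <- s) c a *: delta R a) x *: F x =
  \sum_(a <- s) c a *: F a.
Proof.
move=> us; have val_s x : \val (\sum_(a <- s) c a *: delta R a) x = if x \in s then c x else 0.
  rewrite coord_sum; under eq_bigr do rewrite coord_Zdelta.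
  have [xs|xs] := ifP.
    by rewrite (bigD1_seq x) //= eqxx big1 ?addr0 // => y /negbTE yx; rewrite eq_sym yx.
  rewrite big_seq big1 // => y ys.
  by case: eqVneq => [xy|//]; rewrite -xy xs in ys.
rewrite -(fsbig_widen [set` s]) //.
  rewrite -fsbig_seq // big_seq [RHS]big_seq; apply: eq_bigr => a as_.
  by rewrite val_s as_.
by move=> x [_ /negP/negbTE xs] /=; rewrite val_s xs scale0r.
Qed.

Lemma sum_pair (U W : nmodType) (I : Type) (s : seq I) (F : I -> U) (G : I -> W) :
  \sum_(i <- s) (F i, G i) = (\sum_(i <- s) F i, \sum_(i <- s) G i).
Proof. by elim: s => [|i s IHs]; rewrite ?big_nil // !big_cons IHs. Qed.

(** In this form, inclusions between closures need only be checked on generators. *)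
Lemma jacobiE : jacobi lambda beta = lin (range jacobi_pair).
Proof.
apply/seteqP; split=> [[f g] /= [/lin_range_uniq[s [c [us fE]]] gE]|[f g]].
  have -> : (f, g) = \sum_(a <- s) c a *: jacobi_pair a.
    move: fE gE => /= -> ->; rewrite delta_expansion //.
    by rewrite -sum_pair.
  apply: (subspace_sum (S := lin _)) => [|a _]; first exact: lin_subspace.
  by apply: subspaceZ; [exact: lin_subspace|apply: sub_lin; exists a].
move=> /lin_range_uniq[s [c [us ->]]].
rewrite [X in jacobi _ _ X]sum_pair; split=> /=; last by rewrite delta_expansion.
apply: (subspace_sum (S := lin _)) => [|a _]; first exact: lin_subspace.
by apply: subspaceZ; [exact: lin_subspace|apply: sub_lin; exists a].
Qed.

Lemma lsum_lin (M : normedModType R[i]) (D : L -> M) k x : lin (range D) (lsum D k x).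
Proof.
elim: k x => [|k IHk] x; first by apply: sub_lin; exists x.
by apply: (subspace_sum (S := lin _)) => [|i _]; [exact: lin_subspace|exact: IHk].
Qed.

Lemma eigenfun_lin (U : 'I_d.-1 -> 'I_d -> R) (P : forall n, 'I_n -> 'I_n -> R[i])
  (M : normedModType R[i]) (D : L -> M) i : lin (range D) (eigenfun U P D i).
Proof.
have lS := lin_subspace (range D); rewrite /eigenfun /evec /usum.
apply: (subspace_sum (S := lin _)) => // j _; apply: (subspaceZ (S := lin _)) => //.
apply: (subspace_sum (S := lin _)) => // k _; do 2!apply: (subspaceZ (S := lin _)) => //.
exact: lsum_lin.
Qed.

Lemma eigenfun_pair (U : 'I_d.-1 -> 'I_d -> R) (P : forall n, 'I_n -> 'I_n -> R[i])
    (i : eindex) :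
  eigenfun U P jacobi_pair i =
  (eigenfun U P (delta R) i, eigenfun U P (jacobi_delta lambda beta) i).
Proof.
rewrite /eigenfun /evec -[RHS]sum_pair; apply: eq_bigr => j _.
rewrite -[RHS]/(_ *: (_, _)) -sum_pair; congr (_ *: _); apply: eq_bigr => k _.
rewrite -[RHS]/(_ *: (_ *: (_, _))); do 2!congr (_ *: _).
rewrite [LHS]surjective_pairing; congr (_, _).
  exact: (lsum_morph (phi := fst)).
exact: (lsum_morph (phi := snd)).
Qed.

(** Descending through predecessors reaches length 0, and successors climb from there. Every size n
    thus occurs among the matrices. *)
Lemma exists_len n : (0 < d)%N -> exists x : L, len x = n.
Proof.
move=> d0; have [x0] := tree_nonempty L.
have [y y0] : exists y : L, len y = 0%N.
  have [m] := ubnP (len x0); elim: m x0 => // m IHm x0 x0m.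
  have [x1|x1] := posnP (len x0); first by exists x0.
  by apply: (IHm (pr x0 (Ordinal d0))); rewrite -ltnS len_pr // (leq_trans x0m).
by exists (iter n succ y); rewrite len_iter_succ y0 addn0.
Qed.

End jacobi_graph.

(** * Eigenbasis and spectrum of J *)

Theorem theorem2p5 (R : realType) (d : nat) (L : tree d)
    (lambda beta : nat -> R) (p : nat -> {poly R})
    (d_ge2 : (2 <= d)%N)
    (lambda_gt0 : forall n, 0 < lambda n)
    (p0 : p 0%N = 1)
    (p_rec : forall n, 'X * p n =
      (Num.sqrt d%:R * prev_term lambda n) *: prev_term p n + beta n *: p n
      + (Num.sqrt d%:R * lambda n) *: p n.+1) :
  (exists B : set (l2 R L), orthonormal_basis B /\
     forall v, B v -> eigenvector (jacobi lambda beta) v) /\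
  spectrum (closure (jacobi lambda beta : set (l2 R L * l2 R L))) =
  closure ([set z | exists2 n, (1 <= n)%N &
              root (map_poly (real_complex R) (p n)) z] : set R[i]^o).
Proof.
pose a := offdiag (d := d) lambda; pose b : nat -> R[i] := diag beta.
have ra k : a k \is Num.real by rewrite /a /offdiag complex_real.
have rb k : b k \is Num.real by rewrite /b /diag complex_real.
have [U [U_sum U_rows U_cols]] := zero_sum_frame R d_ge2.
pose P n := projT1 (cid (tridiag_spectral n ra rb)).
pose tP n := cid (projT2 (cid (tridiag_spectral n ra rb))).
pose t n := projT1 (tP n).
have P_rows n (r r' : 'I_n) : \sum_k P n r k * (P n r' k)^* = (r == r')%:R.
  by have [H _ _] := projT2 (tP n); exact: H.
have P_cols n (k l : 'I_n) : \sum_r (P n r k)^* * P n r l = (k == l)%:R.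
  by have [_ H _] := projT2 (tP n); exact: H.
have P_eigen n (r l : 'I_n) : \sum_(k < n) P n r k * tridiag a b k l = t n r * P n r l.
  by have [_ _ H] := projT2 (tP n); exact: H.
pose e : eindex -> l2 R L := eigenfun U P (delta R).
pose tau (i : eindex (L := L)) : R[i] := t _ (tagged i).2.
have Je i : eigenfun U P (jacobi_delta lambda beta) i = tau i *: e i.
  exact: (evec_jacobi d_ge2 U_sum P_eigen).
have e_orth i j : l2dot (e i) (e j) = (i == j)%:R.
  case: i j => [z [h r]] [z' [h' r']]; have [zz'|/eqP zz'] := eqVneq z z'.
    subst z'; rewrite eq_Tagged /= xpair_eqE.
    exact: (dot_evec d_ge2 U_rows P_rows).
  have -> : (existT _ z (h, r) == existT _ z' (h', r') :> eindex) = false.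
    by apply/negP => /eqP/(congr1 tag).
  (* [dot_evec_level] expects the higher vertex in the first factor; otherwise the factors are
     exchanged. *)
  have [le|/ltnW le] := leqP (len z') (len z).
    by apply: (dot_evec_level (m := len z - len z') d_ge2 P U_sum);
      [rewrite subnK|exact/nesym].
  rewrite l2dotC [X in X^*%C](dot_evec_level (m := len z' - len z) d_ge2 P U_sum) ?subnK //.
  exact: rmorph0.
pose G i := (e i, tau i *: e i).
have GE : G = eigenfun U P (jacobi_pair lambda beta).
  by apply/funext => i; rewrite eigenfun_pair Je.
have Dclosure y : closure (lin (range G)) (jacobi_pair lambda beta y).
  by rewrite GE; exact: (delta_graph_closure d_ge2 U_cols P_cols).
have closureE : closure (jacobi lambda beta : set (l2 R L * l2 R L)) = closure (lin (range G)).
  rewrite jacobiE; apply/seteqP; split.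
    by apply: closure_lin_min; [exact: lin_subspace|move=> _ [y _ <-]].
  apply: closure_lin_min; first exact: lin_subspace.
  by move=> _ [i _ <-]; apply: subset_closure; rewrite GE; exact: eigenfun_lin.
(* The first component of the graph approximation [Dclosure] already puts each delta in the closed
   span. *)
have e_dense : closure (lin (range e)) = [set: l2 R L].
  apply/seteqP; split=> // f _; have : closure (lin (range (delta R))) f.
    by rewrite closure_lin_delta.
  apply: closure_lin_min; first exact: lin_subspace.
  move=> _ [y _ <-]; apply/closure_normP => eps eps0.
  have /closure_normP/(_ eps eps0)[[f' g'] /lin_range_uniq[s [c [_ fE]]]] := Dclosure y.
  rewrite prod_normE num_gt_max => /andP[/= ff' _]; exists f' => //.
  have := congr1 fst fE; rewrite /= [X in X.1]sum_pair /= => ->.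
  apply: (subspace_sum (S := lin _)) => [|i _]; first exact: lin_subspace.
  by apply: (subspaceZ (S := lin _)); [exact: lin_subspace|apply: sub_lin; exists i].
have e_eigen i : eigenvector (jacobi lambda beta) (e i).
  split; last by exists (tau i); rewrite -[(_, _)]/(G i) jacobiE GE; exact: eigenfun_lin.
  apply/eqP => ei0; have := e_orth i i; rewrite ei0 l2dot0l eqxx => /eqP.
  by rewrite eq_sym oner_eq0.
split.
  exists (range e); split; last by move=> _ [i _ <-].
  split=> //; first by move=> _ [i _ <-]; rewrite e_orth eqxx.
  move=> _ _ [i _ <-] [j _ <-] ij; rewrite e_orth; case: eqVneq => // E.
  by case: ij; rewrite E.
rewrite closureE (spectrum_eigenbasis tau e_orth e_dense); congr closure.
(* Evaluated at a complex point, the recurrence of [p] becomes the one of the matrix with entries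
   [a] and [b]. *)
pose q z n : R[i] := (map_poly (real_complex R) (p n)).[z].
have q0 z : q z 0%N = 1 by rewrite /q p0 rmorph1 hornerC.
have a0 k : a k != 0.
  rewrite /a /offdiag fmorph_eq0 mulf_neq0 ?lt0r_neq0 //; exact: sd_gt0.
have q_rec z n : z * q z n =
    prev_term a n * prev_term (q z) n + b n * q z n + a n * q z n.+1.
  have := congr1 (fun s => (map_poly (real_complex R) s).[z]) (p_rec n).
  rewrite rmorphM /= map_polyX hornerM hornerX -/(q z n) => ->.
  rewrite !rmorphD /= !map_polyZ !hornerD !hornerZ; congr (_ + _ + _).
  by case: n => [|n] /=; rewrite ?mulr0 ?rmorph0 ?mul0r.
have eigenE z n (n0 : (0 < n)%N) : q z n = 0 <-> exists r, t n r = z.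
  exact: (tridiag_eigenvalue a0 (q0 z) (q_rec z) (P_rows n) (P_cols n) (P_eigen n) n0).
apply/seteqP; split=> z.
  move=> [[x [h r]] _ /= tz]; have x0 : (0 < len x)%N by case: (len x) r {tz} => [[]|].
  exists (len x) => //; apply/rootP; apply/(eigenE _ _ x0); exists r; exact: tz.
move=> [n n1 /rootP /(eigenE _ _ n1)[r tr]].
have [x xn] := exists_len (L := L) n (ltnW d_ge2); subst n.
(* An index [h] exists because the zero-sum space is nonzero for d at least 2, so each root is
   attained as an eigenvalue. *)
have h0 : (0 < d.-1)%N by rewrite ltn_predRL.
by exists (existT _ x (Ordinal h0, r)).
Qed.
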